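(* Let $\mathbf R\subset\mathbb R^2$ be a region of area $1$ and let $O$ be a point in the interior of $\mathbf R$. Take $O$ as the origin of polar coordinates and assume that $\partial\mathbf R$ is the curve $\{(r(\theta),\theta):\theta\in[0,2\pi]\}$, where $r$ is positive, continuous and piecewise differentiable. Let $\mathcal P$ be the probability that $\triangle ABC$ contains $O$, where $A,B,C$ are independent and uniformly distributed in $\mathbf R$. For $\theta\in[0,2\pi]$, let $H(\theta)=\frac12\int_\theta^{\theta+\pi}r(\phi)^2\,d\phi$; this is the area of the part of $\mathbf R$ lying to the right of the line through the boundary points at angles $\theta$ and $\theta+\pi$. Let $h=\min_\theta H(\theta)$. Then $$\frac14-(1+4h)\Big(\frac12-h\Big)^2\le\mathcal P\le\frac14-2\Big(\frac12-h\Big)^3 .$$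
   Context: The function $r$ is extended $2\pi$-periodically. *)

(* Defs.v *)
From HB Require Import structures.
From mathcomp Require Import all_boot all_order all_algebra.
From mathcomp Require Import all_classical all_reals all_analysis.
Set Implicit Arguments. Unset Strict Implicit. Unset Printing Implicit Defensive.
Import Order.TTheory GRing.Theory Num.Theory.
Import numFieldNormedType.Exports.
Local Open Scope classical_set_scope.
Local Open Scope ring_scope.

Section Defs.
Variable R : realType.

Definition leb2 := ((@lebesgue_measure R) \x (@lebesgue_measure R))%E.

Definition polar_region (r : R -> R) : set (R * R) :=
  [set p | exists rho phi, 0 <= rho <= r phi /\
                           p = (rho * cos phi, rho * sin phi)].

Definition triangle_contains_origin (A B C : R * R) : Prop :=
  exists a b c : R, [/\ 0 <= a, 0 <= b, 0 <= c & a + b + c = 1] /\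
    a * A.1 + b * B.1 + c * C.1 = 0 /\ a * A.2 + b * B.2 + c * C.2 = 0.

(* Probability that the triangle of three independent uniform points of the
   region (of area 1, so the uniform law is the restriction of Lebesgue measure)
   contains O. *)
Definition prob_contains_origin (r : R -> R) : \bar R :=
  ((leb2 \x leb2) \x leb2)%E
    [set t | polar_region r t.1.1 /\ polar_region r t.1.2 /\ polar_region r t.2
             /\ triangle_contains_origin t.1.1 t.1.2 t.2].

Definition Hhalf (r : R -> R) (theta : R) : \bar R :=
  ((2^-1)%:E * \int[@lebesgue_measure R]_(x in `[theta, (theta + pi)%R]) ((r x) ^+ 2)%:E)%E.

Definition piecewise_derivable (r : R -> R) : Prop :=
  exists s : seq R, forall x, 0 <= x <= 2 * pi -> x \notin s -> derivable r x 1.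

End Defs.

(* Main.v *)
Require Import Defs.
From HB Require Import structures.
From mathcomp Require Import all_boot all_order all_algebra.
From mathcomp Require Import all_classical all_reals all_analysis.
From mathcomp Require Import measurable_realfun.
From mathcomp Require Import ring lra.
Import Order.TTheory GRing.Theory Num.Theory.
Import numFieldNormedType.Exports.
Local Open Scope classical_set_scope.
Local Open Scope ring_scope.

(** For a point A of the region let K(A) be the area of the part of the region
    strictly to the left of the ray OA.  Outside a null set, the triangles that
    miss O are those having exactly one vertex from which the two others are
    seen on the left, so P = 1 - 3 E[K^2]; moreover E[K] = 1/2 because A and B
    are exchangeable.  Hence P = 1/4 - 3 E[(K - 1/2)^2].

    Along a ray of angle t, K is the constant H(t).  Put g = H - 1/2 and
    d = 1/2 - h; then g(t + pi) = - g(t), |g| <= d, and g runs from - d to d on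
    some interval [t0, t0 + pi].  The variation of g over [x, y] is at most the
    area of the region inside the double cone of angles [x, y] and
    [x + pi, y + pi].  Therefore, for an even nonnegative weight w with
    primitive W, the integral of w(K - 1/2) over the region is at least
    W(d) - W(- d).  The weights u^2 and d^2 - u^2 give
    2/3 d^3 <= E[(K - 1/2)^2] <= d^2 - 4/3 d^3, which is the claim.

    No change of variables to polar coordinates is used: that the sector of
    angles [x, y] has area 1/2 int_x^y r^2 follows by comparing thin sectors with
    right triangles, since planar Lebesgue measure is invariant under shears,
    hence under rotations. *)

(** * Cyclic triples of independent points *)

Section CyclicTriples.
Context {d : measure_display} {T : measurableType d} {R : realType}.
Variable mu : {sigma_finite_measure set T -> \bar R}.
(** Up to a null set [D] is a tournament on the probability space [A]. In the application [D (a, b)]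
    says that b is strictly to the left of the ray from the origin through a, and [k a] is the area
    to the left of that ray. *)
Variables (A : set T) (D : set (T * T)).
Hypotheses (mA : measurable A) (muA : mu A = 1%E).
Hypotheses (mD : measurable D) (DA : D `<=` A `*` A).
Hypothesis D_asym : forall a b, D (a, b) -> ~ D (b, a).
Let converse (D : set (T * T)) : set (T * T) := [set p | D (p.2, p.1)].
Hypothesis D_total : (mu \x mu)%E ((A `*` A) `\` (D `|` converse D)) = 0%E.

Let k (a : T) : \bar R := mu (xsection D a).

Lemma measurable_converse (X : set (T * T)) : measurable X -> measurable (converse X).
Proof.
move=> mX.
have mf : measurable_fun setT (fun p : T * T => (p.2, p.1)).
  by apply: measurable_fun_pair.
by rewrite /converse -[X in measurable X]setTI; exact: mf.
Qed.


(** The product measure is defined by integrating x-sections; by uniqueness on rectangles it agrees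
    with [\x^], which integrates y-sections. *)
Lemma integral_ysectionE {d1 d2} {T1 : measurableType d1} {T2 : measurableType d2}
  (m1 : {sigma_finite_measure set T1 -> \bar R})
  (m2 : {sigma_finite_measure set T2 -> \bar R}) (X : set (T1 * T2)) :
  measurable X -> ((m1 \x m2) X = \int[m2]_y m1 (ysection X y))%E.
Proof.
move=> mX; transitivity ((m1 \x^ m2) X)%E => //.
by apply: product_measure_unique => //= *; rewrite product_measure2E.
Qed.

Lemma measure_converse (X : set (T * T)) : measurable X ->
  (mu \x mu)%E (converse X) = (mu \x mu)%E X.
Proof.
move=> mX; rewrite integral_ysectionE; last exact: measurable_converse.
rewrite [RHS]/product_measure1; apply: eq_integral => x _ /=.
by congr (mu _); apply/seteqP; split => y; rewrite /xsection /ysection/= !inE.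
Qed.

Lemma section_measure_le1 a : (k a <= 1)%E.
Proof.
rewrite -muA; apply: le_measure; rewrite ?inE//; first exact: measurable_xsection.
by move=> b; rewrite /xsection /= inE => /DA[].
Qed.

Lemma section_measure_ge0 a : (0 <= k a)%E. Proof. exact: measure_ge0. Qed.

Lemma measurable_section_measure : measurable_fun [set: T] (k : T -> \bar R).
Proof. exact: measurable_fun_xsection. Qed.

Lemma section_measure_out a : ~ A a -> k a = 0%E.
Proof.
move=> nAa; rewrite /k (_ : xsection D a = set0) ?measure0//.
by apply/seteqP; split => // b; rewrite /xsection /= inE => /DA[].
Qed.

(** [D] and its converse are disjoint, have the same measure and fill [A] x [A] up to a null set.
    This is E[K] = 1/2, written as a sum to avoid dividing extended reals. *)
Lemma integral_section_measure : (\int[mu]_a k a + \int[mu]_a k a = 1)%E.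
Proof.
have mS : measurable (converse D) by exact: measurable_converse.
have -> : (\int[mu]_a k a = (mu \x mu) D)%E by [].
rewrite -{2}(measure_converse _ mD) -measureU//; last first.
  by apply/seteqP; split => // -[a b] [/= /D_asym].
have mAA : measurable (A `*` A) by exact: measurableX.
have mDD : measurable (D `|` converse D) by exact: measurableU.
rewrite -[LHS]adde0 -D_total -measureU//.
- rewrite setDUK; first by rewrite /= product_measure1E// muA mule1.
  by move=> [a b] [/DA//|/DA/= []]; split.
- exact: measurableD.
- by rewrite setDE setICA setICr setI0.
Qed.

(* In TA, TB and TC the two other points are to the left of the first, the
   second and the third point, respectively. *)
Let TA : set (T * T * T) := [set t | D (t.1.1, t.1.2) /\ D (t.1.1, t.2)].
Let TB : set (T * T * T) := [set t | D (t.1.2, t.2) /\ D (t.1.2, t.1.1)].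
Let TC : set (T * T * T) := [set t | D (t.2, t.1.1) /\ D (t.2, t.1.2)].

Lemma measurable_pull (f g : T * T * T -> T) (X : set (T * T)) :
  measurable_fun setT f -> measurable_fun setT g ->
  measurable X -> measurable [set t | X (f t, g t)].
Proof.
move=> mf mg mX.
have mfg : measurable_fun setT (fun t => (f t, g t)) by exact: measurable_fun_pair.
by rewrite -[X in measurable X]setTI; exact: mfg.
Qed.

Let m11 : measurable_fun [set: T * T * T] (fun t => t.1.1).
Proof. exact: (measurableT_comp measurable_fst measurable_fst). Qed.
Let m12 : measurable_fun [set: T * T * T] (fun t => t.1.2).
Proof. exact: (measurableT_comp measurable_snd measurable_fst). Qed.
Let m2 : measurable_fun [set: T * T * T] (fun t => t.2).
Proof. exact: measurable_snd. Qed.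

Lemma measurable_TA : measurable TA.
Proof. by apply: measurableI; apply: measurable_pull. Qed.
Lemma measurable_TB : measurable TB.
Proof. by apply: measurableI; apply: measurable_pull. Qed.
Lemma measurable_TC : measurable TC.
Proof. by apply: measurableI; apply: measurable_pull. Qed.

Let k2 (a : T) : \bar R := (k a * k a)%E.
Let mu3 := ((mu \x mu) \x mu)%E.

(** Measure of the set of third points c that put (a, b, c) in [TA]; integrating it over b gives the
    square of [k a]. *)
Let f (p : T * T) : \bar R := ((\1_D p)%:E * k p.1)%E.
Let weight_ge0 p : (0 <= f p)%E. Proof. by rewrite mule_ge0// section_measure_ge0. Qed.
Let measurable_weight : measurable_fun setT f.
Proof.
apply: emeasurable_funM.
  by apply: measurableT_comp => //; exact: measurable_indic.
by apply: measurableT_comp; [exact: measurable_section_measure|].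
Qed.

Let inner a : (\int[mu]_b f (a, b) = k2 a)%E.
Proof.
rewrite /f /k2 /= ge0_integralZr//; last first.
  apply/measurable_EFinP.
  exact: (measurableT_comp (measurable_indic mD) (pair1_measurable a)).
congr (_ * _)%E.
by rewrite -[RHS](congr1 (fun g => g a) (indic_fubini_tonelli_FE mu mD)).
Qed.

Lemma measure_TA : mu3 TA = (\int[mu]_a k2 a)%E.
Proof.
under [RHS]eq_integral do rewrite -inner.
rewrite -[RHS](fubini_tonelli1 f)//.
apply: eq_integral => -[a b] _; rewrite /f /= indicE.
case: (boolP ((a, b) \in D)) => abD; rewrite ?mul1e ?mul0e.
  congr (mu _); apply/seteqP.
  by split => c; rewrite /xsection /= !inE => //=; [case|split => //; apply/set_mem].
rewrite (_ : xsection _ _ = set0) ?measure0//; apply/seteqP; split => // c.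
by rewrite /xsection /= inE => -[/mem_set]; rewrite (negbTE abD).
Qed.

(** As for [TA], with the first two points exchanged: the section over (a, b) has measure
    [f (b, a)], so Fubini swaps a and b. *)
Lemma measure_TB : mu3 TB = (\int[mu]_a k2 a)%E.
Proof.
under [RHS]eq_integral do rewrite -inner.
rewrite -(@fubini_tonelli _ _ _ _ _ mu mu (fun p => f (p.2, p.1)))//; last first.
  by apply: measurableT_comp => //; apply: measurable_fun_pair.
rewrite -(fubini_tonelli1 (fun p => f (p.2, p.1)))//; last first.
  by apply: measurableT_comp => //; apply: measurable_fun_pair.
apply: eq_integral => -[a b] _; rewrite /f /= indicE.
case: (boolP ((b, a) \in D)) => abD; rewrite ?mul1e ?mul0e.
  congr (mu _); apply/seteqP.
  by split => c; rewrite /xsection /= !inE => //=; [case|split => //; apply/set_mem].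
rewrite (_ : xsection _ _ = set0) ?measure0//; apply/seteqP; split => // c.
by rewrite /xsection /= inE => -[_ /mem_set]; rewrite (negbTE abD).
Qed.


(** The distinguished point is now the innermost variable of integration. For each fixed a, the set
    [X] of admissible pairs (b, c) is measured through its y-sections, which brings c outside b. *)
Lemma measure_TC : mu3 TC = (\int[mu]_a k2 a)%E.
Proof.
under [RHS]eq_integral do rewrite -inner.
rewrite (@fubini_tonelli _ _ _ _ _ mu mu f)//.
pose phi := (mu \o xsection TC) : T * T -> \bar R.
have mphi : measurable_fun setT phi.
  by apply: measurable_fun_xsection; exact: measurable_TC.
transitivity (\int[mu \x mu]_p phi p)%E; first by [].
rewrite (fubini_tonelli1 phi mphi); last by move=> p; exact: measure_ge0.
apply: eq_integral => a _.
rewrite /fubini_F /phi.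
pose X : set (T * T) := [set p | D (p.2, a) /\ D (p.2, p.1)].
have mX : measurable X.
  apply: measurableI; last exact: measurable_converse.
  have mf : measurable_fun setT (fun p : T * T => (p.2, a)).
    by apply: measurable_fun_pair => //; exact: measurable_snd.
  by rewrite -[X in measurable X]setTI; exact: mf.
transitivity ((mu \x mu)%E X).
  rewrite /product_measure1; apply: eq_integral => b _ /=; congr (mu _).
rewrite [LHS](integral_ysectionE mu mu _ mX); apply: eq_integral => c _; rewrite /f /= indicE.
case: (boolP ((c, a) \in D)) => abD; rewrite ?mul1e ?mul0e.
  congr (mu _); apply/seteqP.
  split => b; rewrite /xsection /ysection /= !inE => //=; [by case|split => //].
  exact/set_mem.
rewrite (_ : ysection _ _ = set0) ?measure0//; apply/seteqP; split => // b.
by rewrite /ysection /= inE => -[/mem_set]; rewrite (negbTE abD).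
Qed.


(** The pairs that [D] compares in neither direction. [Z12], [Z23] and [Z13] collect the triples
    having such a pair, and all three are null. *)
Let Z : set (T * T) := (A `*` A) `\` (D `|` converse D).
Let mZ : measurable Z.
Proof.
by apply: measurableD; [exact: measurableX|apply: measurableU => //; exact: measurable_converse].
Qed.

Let Z12 : set (T * T * T) := [set t | Z (t.1.1, t.1.2)].
Let Z23 : set (T * T * T) := [set t | Z (t.1.2, t.2)].
Let Z13 : set (T * T * T) := [set t | Z (t.1.1, t.2)].

Lemma measure_Z12 : mu3 Z12 = 0%E.
Proof.
have -> : Z12 = Z `*` setT.
  by apply/seteqP; split => [[[a b] c]|[[a b] c] []].
by rewrite [LHS](product_measure1E (mu \x mu)%E mu)// [X in (X * _)%E]D_total mul0e.
Qed.

Let z (a : T) : \bar R := mu (xsection Z a).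
Let mz : measurable_fun setT z. Proof. exact: measurable_fun_xsection. Qed.
Let z_ge0 a : (0 <= z a)%E. Proof. exact: measure_ge0. Qed.

Lemma measure_Z23 : mu3 Z23 = 0%E.
Proof.
have mzz : measurable_fun setT (fun p : T * T => z p.2).
  by apply: measurableT_comp => //; exact: measurable_snd.
transitivity (\int[mu \x mu]_p z p.2)%E.
  apply: eq_integral => -[a b] _ /=.
  by rewrite /z; congr (mu _); apply/seteqP; split => c; rewrite /xsection /= !inE.
rewrite (fubini_tonelli1 (fun p => z p.2))// /fubini_F /=.
by rewrite -[RHS](@integral0_eq _ _ _ mu setT (fun=> 0%E))//; apply: eq_integral.
Qed.

Lemma measure_Z13 : mu3 Z13 = 0%E.
Proof.
have mzz : measurable_fun setT (fun p : T * T => z p.1).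
  by apply: measurableT_comp => //; exact: measurable_fst.
transitivity (\int[mu \x mu]_p z p.1)%E.
  apply: eq_integral => -[a b] _ /=.
  by rewrite /z; congr (mu _); apply/seteqP; split => c; rewrite /xsection /= !inE.
rewrite (fubini_tonelli1 (fun p => z p.1))//.
rewrite (@fubini_tonelli _ _ _ _ _ mu mu (fun p => z p.1))// /=.
by rewrite -[RHS](@integral0_eq _ _ _ mu setT (fun=> 0%E))//; apply: eq_integral.
Qed.

(** A tournament on three vertices is either cyclic or has exactly one vertex dominating the two
    others. So [E], [TA], [TB] and [TC] are disjoint and fill the cube of [A] up to a null set. On
    triples with an uncompared pair nothing has to be known about [E]. *)
Lemma measure_cyclic (E : set (T * T * T)) : measurable E ->
  E `<=` (A `*` A) `*` A ->
  (forall a b c, D (a, b) -> D (b, c) -> D (c, a) -> E (a, b, c)) ->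
  (forall a b c, D (b, a) -> D (c, b) -> D (a, c) -> E (a, b, c)) ->
  (forall a b c, E (a, b, c) -> D (a, b) -> ~ D (a, c)) ->
  (forall a b c, E (a, b, c) -> D (b, c) -> ~ D (b, a)) ->
  (forall a b c, E (a, b, c) -> D (c, a) -> ~ D (c, b)) ->
  (mu3 E + ((\int[mu]_a k2 a + \int[mu]_a k2 a) + \int[mu]_a k2 a) = 1)%E.
Proof.
move=> mE EA Epos Eneg EnTA EnTB EnTC.
rewrite -{1}measure_TA -{1}measure_TB -measure_TC.
have mTA := measurable_TA; have mTB := measurable_TB; have mTC := measurable_TC.
have mAB : measurable (TA `|` TB) by exact: measurableU.
have mABC : measurable (TA `|` TB `|` TC) by exact: measurableU.
have mX : measurable (E `|` (TA `|` TB `|` TC)) by exact: measurableU.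
rewrite -(@measureU _ _ _ (mu \x mu \x mu)%E TA TB)//; last first.
  by apply/seteqP; split => // -[[a b] c] [[/= ? ?] [/= ? /D_asym]].
rewrite -(@measureU _ _ _ (mu \x mu \x mu)%E (TA `|` TB) TC)//; last first.
  apply/seteqP; split => // -[[a b] c] [[[/= ? ?]|[/= ? ?]] [/= ? ?]].
    exact: (D_asym a c).
  exact: (D_asym b c).
rewrite -(@measureU _ _ _ (mu \x mu \x mu)%E E (TA `|` TB `|` TC))//; last first.
  apply/seteqP; split => // -[[a b] c] [Eabc [[[/= ? ?]|[/= ? ?]]|[/= ? ?]]].
  - exact: (EnTA a b c).
  - exact: (EnTB a b c).
  - exact: (EnTC a b c).
have mAA : measurable ((A `*` A) `*` A) by do 2! apply: measurableX => //.
have A3 : mu3 ((A `*` A) `*` A) = 1%E.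
  rewrite [LHS](product_measure1E (mu \x mu)%E mu)//; last exact: measurableX.
  by rewrite [X in (X * _)%E]product_measure1E// muA !mule1.
have mZ12 : measurable Z12 by apply: measurable_pull.
have mZ23 : measurable Z23 by apply: measurable_pull.
have mZ13 : measurable Z13 by apply: measurable_pull.
apply/eqP; rewrite eq_le -{1}A3; apply/andP; split.
  apply: le_measure; rewrite ?inE//.
  move=> [[a b] c] [/EA//|[[[/= /DA[/= ? ?] /DA[/= ? ?]]|[/= /DA[/= ? ?] /DA[/= ? ?]]]|
    [/= /DA[/= ? ?] /DA[/= ? ?]]]]; by split.
have mZZ : measurable (Z12 `|` Z23) by exact: measurableU.
have mN : measurable (Z12 `|` Z23 `|` Z13) by exact: measurableU.
have N0 : mu3 (Z12 `|` Z23 `|` Z13) = 0%E.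
  rewrite [LHS]measureU0//; last exact: measure_Z13.
  by rewrite [LHS]measureU0//; [exact: measure_Z12|exact: measure_Z23].
rewrite -A3 -[leRHS](measureU0 mX mN N0).
apply: le_measure; rewrite ?inE//; first exact: measurableU.
move=> [[a b] c] [[/= Aa Ab] Ac].
(* Off the null set there are eight orientations of the three pairs: two are cyclic and go to [E],
   six are transitive and go to the set of their dominating vertex. *)
have sgn x y : A x -> A y -> [\/ D (x, y), D (y, x) | Z (x, y)].
  move=> Ax Ay; have [Dxy|nDxy] := pselect (D (x, y)); first by constructor 1.
  have [Dyx|nDyx] := pselect (D (y, x)); first by constructor 2.
  by constructor 3; split => // -[].
have [ab|ba|zab] := sgn a b Aa Ab; last by right; left; left.
- have [bc|cb|zbc] := sgn b c Ab Ac; last by right; left; right.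
  + have [ac|ca|zac] := sgn a c Aa Ac; last by right; right.
      by left; right; left; left.
    by left; left; exact: Epos.
  + have [ac|ca|zac] := sgn a c Aa Ac; last by right; right.
      by left; right; left; left.
    by left; right; right.
- have [bc|cb|zbc] := sgn b c Ab Ac; last by right; left; right.
    by left; right; left; right.
  have [ac|ca|zac] := sgn a c Aa Ac; last by right; right.
    by left; left; exact: Eneg.
  by left; right; right.
Qed.


(** The integral of k squared is the variance V plus 1/4, since k has mean 1/2; hence 1 - 3 (V +
    1/4) = 1/4 - 3 V. *)
Lemma measure_cyclic_variance (E : set (T * T * T)) : measurable E ->
  E `<=` (A `*` A) `*` A ->
  (forall a b c, D (a, b) -> D (b, c) -> D (c, a) -> E (a, b, c)) ->
  (forall a b c, D (b, a) -> D (c, b) -> D (a, c) -> E (a, b, c)) ->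
  (forall a b c, E (a, b, c) -> D (a, b) -> ~ D (a, c)) ->
  (forall a b c, E (a, b, c) -> D (b, c) -> ~ D (b, a)) ->
  (forall a b c, E (a, b, c) -> D (c, a) -> ~ D (c, b)) ->
  exists2 V : R, (\int[mu]_(a in A) ((fine (k a) - 2^-1) ^+ 2)%:E = V%:E)%E &
    mu3 E = (4^-1 - 3 * V)%:E.
Proof.
move=> mE EA E1 E2 E3 E4 E5.
have kfin a : k a = (fine (k a))%:E.
  by rewrite fineK// ge0_fin_numE ?section_measure_ge0// (le_lt_trans (section_measure_le1 a))// ltry.
have mk := measurable_section_measure.
have mfk : measurable_fun setT (fine \o k) by exact: measurableT_comp.
have mfkA : measurable_fun A (fine \o k) by exact: measurable_funTS.
have mkA : measurable_fun A (k : T -> \bar R) by exact: measurable_funTS.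
pose v a := ((fine (k a) - 2^-1) ^+ 2)%:E.
have mv : measurable_fun A v.
  by apply/measurable_EFinP/measurable_funX/measurable_funB.
have mk2 : measurable_fun A k2 by apply: emeasurable_funM.
have v0 a : (0 <= v a)%E by rewrite lee_fin sqr_ge0.
have k20 a : (0 <= k2 a)%E by rewrite mule_ge0 ?section_measure_ge0.
have restr (g : T -> \bar R) : (forall a, ~ A a -> g a = 0%E) ->
    (\int[mu]_a g a = \int[mu]_(a in A) g a)%E.
  move=> g0; rewrite [RHS]integral_mkcond; apply: eq_integral => a _.
  by rewrite patchE; case: ifPn => // /negP aA; apply: g0 => Aa; apply: aA; exact/mem_set.
(* The identity (k - 1/2)^2 + k = k^2 + 1/4 is arranged without subtraction, so that additivity for
   nonnegative functions applies. *)
have key : (\int[mu]_(a in A) v a + \int[mu]_(a in A) k a =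
            \int[mu]_(a in A) k2 a + (4^-1)%:E)%E.
  have <- : (\int[mu]_(a in A) (4^-1)%:E = (4^-1 : R)%:E)%E.
    by rewrite integral_cst// [X in (_ * X)%E]muA mule1.
  rewrite -ge0_integralD//.
  rewrite -ge0_integralD//.
  apply: eq_integral => a _; rewrite /v /k2 kfin -!EFinD/=; congr (_%:E).
  by field.
have cyc := measure_cyclic E mE EA E1 E2 E3 E4 E5.
have half_area := integral_section_measure.
have Ek : (\int[mu]_a k a = \int[mu]_(a in A) k a)%E by apply: restr => a /section_measure_out.
have Ek2 : (\int[mu]_a k2 a = \int[mu]_(a in A) k2 a)%E.
  by apply: restr => a /section_measure_out; rewrite /k2 => ->; rewrite mul0e.
rewrite Ek in half_area; rewrite Ek2 in cyc.
have K0 : (0 <= \int[mu]_(a in A) k a)%E by apply: integral_ge0 => a _; exact: section_measure_ge0.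
have K20 : (0 <= \int[mu]_(a in A) k2 a)%E by apply: integral_ge0 => a _; exact: k20.
have V0 : (0 <= \int[mu]_(a in A) v a)%E by apply: integral_ge0 => a _; exact: v0.
have M0 : (0 <= mu3 E)%E by exact: (measure_ge0 (mu \x mu \x mu)%E).
move: K0 K20 V0 M0 half_area cyc key.
move: (mu3 E) (\int[mu]_(a in A) k a)%E (\int[mu]_(a in A) k2 a)%E
  (\int[mu]_(a in A) v a)%E.
(* Nonnegativity and the three equations leave only the case where all four quantities are
   finite. *)
move=> [m| |] [K| |] [K2| |] [V| |] //= _ _ _ _ [half_area] [cyc] [key].
by exists V => //; congr (_%:E); lra.
Qed.

End CyclicTriples.

(** * Lebesgue measure on the plane *)

HB.instance Definition _ (R : realType) := Measure.on (@leb2 R).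

Lemma leb2_sigma_finite (R : realType) : sigma_finite setT (@leb2 R).
Proof.
have /sigma_finiteP[F [TF ndF Foo]] := sigma_finiteT (@lebesgue_measure R).
exists (fun n => F n `*` F n).
  rewrite -setXTT TF predeqE => -[x y]; split.
    move=> [/= [n _ Fnx] [k _ Fky]]; exists (maxn n k) => //; split.
    - by move: x Fnx; exact/subsetPset/ndF/leq_maxl.
    - by move: y Fky; exact/subsetPset/ndF/leq_maxr.
  by move=> [n _ []/= ? ?]; split; exists n.
move=> n; have [mF Fn] := Foo n; split; first exact: measurableX.
by rewrite [ltLHS](product_measure1E lebesgue_measure lebesgue_measure)// lte_mul_pinfty// ge0_fin_numE.
Qed.

HB.instance Definition _ (R : realType) :=
  Measure_isSigmaFinite.Build _ _ _ (@leb2 R) (leb2_sigma_finite R).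

Section Plane.
Variable R : realType.
Notation plane := (measurableTypeR R * measurableTypeR R)%type.
Notation mu := (@leb2 R).
Notation leb := (@lebesgue_measure R).

(** The plane carries the product sigma-algebra, so [U] is written as a countable union of products:
    the boxes inside [U] with rational centre and radius 1/(n+1). *)
Lemma open_measurable_plane (U : set (R * R)) : open U -> measurable (U : set plane).
Proof.
move=> oU.
pose box (i : nat * (rat * rat)) : set plane :=
  ball (ratr i.2.1 : R) i.1.+1%:R^-1 `*` ball (ratr i.2.2 : R) i.1.+1%:R^-1.
have -> : U = \bigcup_i [set p | box i p /\ box i `<=` U].
  apply/seteqP; split => [[x y] Uxy|p [i _ [bp]]]; last exact.
  have /nbhs_ballP[e /= e0 eU] : nbhs (x, y) U by exact: open_nbhs_nbhs.
  have e20 : 0 < e / 2 by rewrite divr_gt0.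
  have [n _ ne] : \forall n \near \oo, n.+1%:R^-1 < e / 2 :> R.
    exact: (near_infty_natSinv_lt (PosNum e20)).
  have {}ne := ne n (leqnn n).
  have n0 : 0 < n.+1%:R^-1 :> R by rewrite invr_gt0.
  have approx (d t : R) : 0 < d -> exists q : rat, ball (ratr q : R) d t.
    move=> d0; have [|q] := @rat_in_itvoo R (t - d) (t + d); first by lra.
    rewrite in_itv /= => /andP[q1 q2]; exists q.
    by rewrite /ball /= ltr_norml; apply/andP; split; lra.
  have close (d u v w : R) : d < e / 2 -> ball u d v -> ball u d w -> ball v e w.
    rewrite /ball /= !ltr_norml => de /andP[? ?] /andP[? ?].
    by apply/andP; split; lra.
  have [[q1 bq1] [q2 bq2]] := (approx _ x n0, approx _ y n0).
  exists (n, (q1, q2)) => //; split; first by split.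
  move=> [x' y'] [/= b1 b2]; apply: eU; split => /=.
  - exact: close ne bq1 b1.
  - exact: close ne bq2 b2.
apply: countable_bigcupT_measurable => [|i].
  exact: countableP.
have [bU|nbU] := pselect (box i `<=` U).
  rewrite (_ : [set p | _] = box i); last by apply/seteqP; split => p //= [].
  by apply: measurableX; apply: measurable_ball.
rewrite (_ : [set p | _] = set0)//.
by apply/seteqP; split => p //= [].
Qed.

Lemma closed_measurable_plane (U : set (R * R)) : closed U -> measurable (U : set plane).
Proof.
by move=> cU; rewrite -[U]setCK; apply: measurableC; apply: open_measurable_plane; exact: closed_openC.
Qed.


(** * Invariance under translations, shears and rotations *)

Definition translation (t x : measurableTypeR R) : measurableTypeR R := x + t.

Lemma measurable_translation t : measurable_fun setT (translation t).
Proof. exact: measurable_funD. Qed.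

HB.instance Definition _ t := isMeasurableFun.Build _ _ _ _ _ (measurable_translation t).

(** The pushforward by a translation gives half-open intervals their length, which characterises
    Lebesgue measure. *)
Lemma lebesgue_translation (t : R) (X : set (measurableTypeR R)) : measurable X ->
  leb (translation t @^-1` X) = leb X.
Proof.
move=> mX; apply/esym.
rewrite -/(pushforward leb (translation t) X).
apply: lebesgue_measure_unique => //= _ [[a b]] _ <-.
rewrite /pushforward.
rewrite (_ : _ @^-1` _ = `]a - t, b - t]%classic); last first.
  by apply/seteqP; split => x; rewrite /translation /= !in_itv /= => /andP[? ?]; apply/andP; split; lra.
rewrite !lebesgue_measure_itv/= !lte_fin ltrD2r; case: ifPn => // _.
by rewrite -!EFinB; congr (_%:E); lra.
Qed.

Lemma measurable_linear (a b c d : R) :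
  measurable_fun setT (fun p : plane => (a * p.1 + b * p.2, c * p.1 + d * p.2) : plane).
Proof.
by apply: measurable_fun_pair; apply: measurable_funD; apply: measurable_funM;
  first [exact: measurable_cst | exact: measurable_fst | exact: measurable_snd].
Qed.


Lemma measurable_linear_preimage (a b c d : R) (X : set plane) : measurable X ->
  measurable [set p : plane | X (a * p.1 + b * p.2, c * p.1 + d * p.2)].
Proof.
move=> mX; rewrite -[X in measurable X]setTI.
exact: (measurable_linear a b c d measurableT _ mX).
Qed.

(** A vertical shear only translates each vertical section. The entries 0 and 1 are kept so that the
    set has the shape of [measurable_linear_preimage]. *)
Lemma leb2_shear_y (t : R) (X : set plane) : measurable X ->
  mu [set p | X (1 * p.1 + 0 * p.2, t * p.1 + 1 * p.2)] = mu X.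
Proof.
move=> mX; rewrite /leb2 /product_measure1; apply: eq_integral => x _ /=.
rewrite -[RHS](lebesgue_translation (t * x)); last exact: measurable_xsection.
congr (leb _); apply/seteqP.
by split => y; rewrite /xsection /translation /= !inE /= !mul1r mul0r addr0 (addrC y).
Qed.

Lemma leb2_shear_x (t : R) (X : set plane) : measurable X ->
  mu [set p | X (1 * p.1 + t * p.2, 0 * p.1 + 1 * p.2)] = mu X.
Proof.
move=> mX; rewrite /leb2.
rewrite (integral_ysectionE leb leb _ (measurable_linear_preimage 1 t 0 1 _ mX)).
rewrite (integral_ysectionE leb leb _ mX).
apply: eq_integral => y _ /=.
rewrite -[RHS](lebesgue_translation (t * y)); last exact: measurable_ysection.
congr (leb _); apply/seteqP.
by split => x; rewrite /ysection /translation /= !inE /= !mul1r mul0r add0r.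
Qed.

(* The rotation is the product of three shears, of slopes t, s and t with
   t = (c - 1) / s. *)
Lemma leb2_rotation_sin_neq0 (c s : R) (X : set plane) : c ^+ 2 + s ^+ 2 = 1 -> s != 0 ->
  measurable X ->
  mu [set p | X (c * p.1 - s * p.2, s * p.1 + c * p.2)] = mu X.
Proof.
move=> cs s0 mX; pose t := (c - 1) / s.
have ts : t * s = c - 1 by rewrite divfK.
have tc : t * (c + 1) = - s.
  rewrite /t mulrAC -subr_sqr expr1n -[X in c ^+ 2 - X]cs opprD addrA subrr add0r.
  by rewrite mulNr expr2 mulfK.
have m1 := measurable_linear_preimage 1 t 0 1 _ mX.
have m2 := measurable_linear_preimage 1 0 s 1 _ m1.
rewrite -(leb2_shear_x t _ mX) -(leb2_shear_y s _ m1) -(leb2_shear_x t _ m2).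
have cE : c = 1 + t * s by rewrite ts addrC subrK.
have sE : - s = t * (2 + t * s) by rewrite -tc cE; ring.
have comp (x y : R) : (c * x - s * y, s * x + c * y) =
    (1 * (1 * (1 * x + t * y) + 0 * (0 * x + 1 * y)) +
       t * (s * (1 * x + t * y) + 1 * (0 * x + 1 * y)),
     0 * (1 * (1 * x + t * y) + 0 * (0 * x + 1 * y)) +
       1 * (s * (1 * x + t * y) + 1 * (0 * x + 1 * y))).
  by congr pair; [rewrite -mulNr sE cE; ring|rewrite cE; ring].
by congr (mu _); apply/seteqP; split => -[x y] /=; rewrite comp.
Qed.

Lemma leb2_rotation (c s : R) (X : set plane) : c ^+ 2 + s ^+ 2 = 1 ->
  measurable X ->
  mu [set p | X (c * p.1 - s * p.2, s * p.1 + c * p.2)] = mu X.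
Proof.
move=> cs mX; have [s0|s0] := eqVneq s 0; last exact: leb2_rotation_sin_neq0.
have /orP[/eqP c1|/eqP c1] : (c == 1) || (c == -1).
  by rewrite -eqf_sqr expr1n -cs s0 expr0n addr0.
  congr (mu _); apply/seteqP.
  by split => -[x y] /=; rewrite c1 s0 !mul1r !mul0r subr0 add0r.
(* The remaining case is the half turn, the square of the quarter turn, whose sine is 1. *)
have cs' : (0 : R) ^+ 2 + 1 ^+ 2 = 1 by rewrite expr0n expr1n add0r.
have m1 := measurable_linear_preimage 0 (- 1) 1 0 _ mX.
have H1 (Y : set plane) : measurable Y -> mu [set p | Y (0 * p.1 + - 1 * p.2, 1 * p.1 + 0 * p.2)] = mu Y.
  move=> mY; rewrite -[RHS](leb2_rotation_sin_neq0 _ _ _ cs' (oner_neq0 R) mY).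
  by congr (mu _); apply/seteqP; split => -[x y] /=; rewrite mulNr.
rewrite -[RHS]H1// -[RHS]H1//.
congr (mu _); apply/seteqP; split => -[x y] /=; rewrite c1 s0;
  by rewrite !mul0r !mul1r !mulN1r !add0r !addr0 subr0.
Qed.

(** A rotation carries the line to the first axis, which is null as a product with a point. *)
Lemma leb2_line (c s : R) : c ^+ 2 + s ^+ 2 = 1 ->
  mu [set p : plane | s * p.1 + c * p.2 = 0] = 0%E.
Proof.
move=> cs; pose L : set plane := setT `*` [set 0].
have mL : measurable L by exact: measurableX.
have L0 : mu L = 0%E.
  rewrite [LHS](product_measure1E leb leb)//.
  by rewrite [X in (_ * X)%E]lebesgue_measure_set1 mule0.
rewrite -L0 -[RHS](leb2_rotation c s _ cs mL).
by congr (mu _); apply/seteqP; split => -[x y] //= [].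
Qed.

(** The right triangle with one leg [0, c] on the first axis and hypotenuse of slope m, by
    integrating its vertical sections. The hypotenuse is left out, as in [cone]. *)
Lemma leb2_triangle (m c : R) : 0 <= m -> 0 < c ->
  mu [set p : plane | [/\ 0 <= p.2, p.2 < m * p.1 & p.1 <= c]] = (m * (c ^+ 2 / 2))%:E.
Proof.
move=> m0 c0; rewrite /leb2 /product_measure1.
transitivity (\int[leb]_(x in `[0%R, c]) (m * x)%:E)%E.
  rewrite [RHS]integral_mkcond; apply: eq_integral => x _ /=.
  rewrite patchE; case: ifPn => [|/negP xc].
    move=> /set_mem /=; rewrite in_itv/= => /andP[x0 xc].
    rewrite (_ : xsection _ _ = `[0, m * x[%classic).
      rewrite lebesgue_measure_itv /= lte_fin oppr0 adde0; case: ltP => // mx.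
      by congr (_%:E); apply/eqP; rewrite eq_le mx mulr_ge0.
    apply/seteqP; split => y; rewrite /xsection /= !inE /=.
      by move=> [y0 ym _]; apply/andP.
    by move=> /andP[y0 ym].
  rewrite (_ : xsection _ _ = set0) ?measure0//; apply/seteqP; split => // y.
  rewrite /xsection /= !inE => -[/= y0 ymx xc']; apply: xc; apply/mem_set; rewrite /= in_itv/= xc' andbT.
  by rewrite leNgt; apply/negP => x0; have := le_lt_trans y0 ymx; rewrite ltNge mulr_ge0_le0// ltW.
pose F (x : R) := m * (x ^+ 2 / 2).
have dF (x : R) : is_derive x 1 F (m * x).
  by rewrite /F; apply: is_derive_eq; rewrite /GRing.scale /=; lra.
have cF : continuous F by move=> x; apply/differentiable_continuous/derivable1_diffP; have [] := dF x.
transitivity ((F c)%:E - (F 0)%:E)%E; last first.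
  by rewrite /F expr0n /= mul0r mulr0 oppr0 adde0.
apply: continuous_FTC2 => //.
- by apply: continuous_subspaceT => x; apply: mulrl_continuous.
- split => [x _||].
  + by have [] := dF x.
  + by apply: cvg_at_right_filter; exact: cF.
  + by apply: cvg_at_left_filter; exact: cF.
- by move=> x _; rewrite derive1E; have [_ ->] := dF x.
Qed.

End Plane.

(** * Cones and polar coordinates *)

Section Cones.
Variable R : realType.
Notation plane := (measurableTypeR R * measurableTypeR R)%type.
Notation mu := (@leb2 R).

(* The determinant of (cos x, sin x) and p: positive iff p is to the left of the
   ray of angle x. *)
Definition side (x : R) (p : R * R) : R := cos x * p.2 - sin x * p.1.
(** For x < y < x + pi this is the angular sector that contains the ray of angle x but neither the
    ray of angle y nor the origin, so that adjacent cones do not overlap. *)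
Definition cone (x y : R) : set (R * R) := [set p | 0 <= side x p /\ side y p < 0].
Definition polar (rho phi : R) : R * R := (rho * cos phi, rho * sin phi).

Lemma side_polar x rho phi : side x (polar rho phi) = rho * sin (phi - x).
Proof. by rewrite /side /polar /= sinB; ring. Qed.

Lemma sideDpi x p : side (x + pi) p = - side x p.
Proof. by rewrite /side cosDpi sinDpi; ring. Qed.

(** The linear relation between three directions. For x <= y <= z within half a turn all sines are
    nonnegative, so two signs of [side] constrain the third. *)
Lemma side_sine_rule x y z p :
  side y p * sin (z - x) = side x p * sin (z - y) + side z p * sin (y - x).
Proof. by rewrite /side !sinB; ring. Qed.

Lemma measurable_fun_side x : measurable_fun setT (side x : plane -> R).
Proof.
by apply: measurable_funB; apply: measurable_funM;
  first [exact: measurable_cst | exact: measurable_fst | exact: measurable_snd].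
Qed.

Lemma measurable_side_gt0 x : measurable ([set p | 0 < side x p] : set plane).
Proof.
rewrite (_ : [set p | _] = side x @^-1` `]0, +oo[); last first.
  by apply/seteqP; split => p /=; rewrite in_itv/= andbT.
by rewrite -[X in measurable X]setTI; apply: measurable_fun_side.
Qed.

Lemma measurable_side_ge0 x : measurable ([set p | 0 <= side x p] : set plane).
Proof.
rewrite (_ : [set p | _] = side x @^-1` `[0, +oo[); last first.
  by apply/seteqP; split => p /=; rewrite in_itv/= andbT.
by rewrite -[X in measurable X]setTI; apply: measurable_fun_side.
Qed.

Lemma measurable_side_lt0 x : measurable ([set p | side x p < 0] : set plane).
Proof.
rewrite (_ : [set p | _] = [set p | 0 < side (x + pi) p]).
  exact: measurable_side_gt0.
by apply/seteqP; split => p /=; rewrite sideDpi oppr_gt0.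
Qed.

Lemma measurable_cone x y : measurable (cone x y : set plane).
Proof.
by apply: measurableI; [exact: measurable_side_ge0|exact: measurable_side_lt0].
Qed.

Lemma side_line x : mu [set p | side x p = 0] = 0%E.
Proof.
rewrite -[RHS](leb2_line _ (cos x) (- sin x)); last first.
  by rewrite sqrrN cos2Dsin2.
by congr (mu _); apply/seteqP; split => p; rewrite /side /= mulNr addrC.
Qed.

Lemma cone_additive x y z : x <= y -> y <= z -> z - x < pi ->
  cone x z = cone x y `|` cone y z.
Proof.
move=> xy yz zx; apply/seteqP; split => [p [sx sz]|p [[sx sy]|[sy sz]]].
- by have [sy|sy] := ltP (side y p) 0; [left|right].
- split => //; have [yx|yx] := eqVneq y x.
    by move: sy; rewrite yx ltNge sx.
  have {}yx : x < y by rewrite lt_neqAle eq_sym yx.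
  have s1 : 0 < sin (y - x) by apply: sin_gt0_pi; lra.
  have s2 : 0 <= sin (z - y) by apply: sin_ge0_pi; lra.
  have s3 : 0 < sin (z - x) by apply: sin_gt0_pi; lra.
  rewrite -(pmulr_llt0 _ s1).
  have := side_sine_rule x y z p; nra.
- split => //; have [zy|zy] := eqVneq z y.
    by move: sz; rewrite zy ltNge sy.
  have {}zy : y < z by rewrite lt_neqAle eq_sym zy.
  have s1 : 0 <= sin (y - x) by apply: sin_ge0_pi; lra.
  have s2 : 0 < sin (z - y) by apply: sin_gt0_pi; lra.
  have s3 : 0 < sin (z - x) by apply: sin_gt0_pi; lra.
  rewrite -(pmulr_lge0 _ s2).
  have := side_sine_rule x y z p; nra.
Qed.

Lemma cone_disjoint x y z : cone x y `&` cone y z = set0.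
Proof.
apply/seteqP; split => // p [[_ sy] [sy' _]].
by move: sy; rewrite ltNge sy'.
Qed.

(** * Reduction of angles and polar coordinates in a cone *)

Lemma periodic_int (T : Type) (f : R -> T) (P : R) : (forall x, f (x + P) = f x) ->
  forall (n : int) x, f (x + n%:~R * P) = f x.
Proof.
move=> fP.
have fn (n : nat) x : f (x + n%:R * P) = f x.
  by elim: n x => [|n IH] x; rewrite ?mul0r ?addr0// -natr1 mulrDl mul1r addrA fP IH.
case=> n x; first by rewrite -pmulrn fn.
by rewrite NegzE -[LHS](fn n.+1); congr f; rewrite mulrNz mulNr -pmulrn addrNK.
Qed.

Lemma angle_reduction (x phi : R) :
  exists n : int, x <= phi + n%:~R * (2 * pi) < x + 2 * pi.
Proof.
have pi0 : 0 < 2 * pi :> R by rewrite mulr_gt0// pi_gt0.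
exists (- Num.floor ((phi - x) / (2 * pi))).
set n := Num.floor _.
have /andP[n1 n2] : n%:~R <= (phi - x) / (2 * pi) < (n + 1)%:~R.
  by rewrite /n real_floor_itv// num_real.
move: n1 n2; rewrite ler_pdivlMr// ltr_pdivrMr// intrD mulrDl mul1r rmorphN/=.
by move=> n1 n2; apply/andP; split; lra.
Qed.

Lemma polar_reduction (r : R -> R) : (forall x, r (x + 2 * pi) = r x) ->
  forall x phi, exists2 psi, x <= psi < x + 2 * pi &
    r psi = r phi /\ forall rho, polar rho psi = polar rho phi.
Proof.
move=> rP x phi; have [n xn] := angle_reduction x phi.
exists (phi + n%:~R * (2 * pi)) => //; split; first exact: periodic_int.
move=> rho; rewrite /polar; congr (_ * _, _ * _); apply: periodic_int => t.
  by rewrite mulr_natl cosD2pi.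
by rewrite mulr_natl sinD2pi.
Qed.


Lemma cone_polar x y p : x <= y <= x + pi -> cone x y p ->
  exists rho phi, [/\ 0 < rho, x <= phi < y & p = polar rho phi].
Proof.
move=> /andP[xy yx] [sx sy].
(* These are the coordinates of p in the frame turned by x. As s >= 0, the angle of p measured from
   x is the arc cosine of c / rho. *)
pose c := cos x * p.1 + sin x * p.2; pose s := side x p.
have n0 : 0 < c ^+ 2 + s ^+ 2.
  have -> : c ^+ 2 + s ^+ 2 = p.1 ^+ 2 + p.2 ^+ 2.
    transitivity ((cos x ^+ 2 + sin x ^+ 2) * (p.1 ^+ 2 + p.2 ^+ 2)).
      by rewrite /c /s /side; ring.
    by rewrite cos2Dsin2 mul1r.
  rewrite lt_neqAle addr_ge0 ?sqr_ge0// andbT eq_sym paddr_eq0 ?sqr_ge0//.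
  rewrite !sqrf_eq0; apply/negP => /andP[/eqP p1 /eqP p2].
  by move: sy; rewrite /side p1 p2 !mulr0 subrr ltxx.
pose rho := Num.sqrt (c ^+ 2 + s ^+ 2).
have rho0 : 0 < rho by rewrite sqrtr_gt0.
have rho2 : rho ^+ 2 = c ^+ 2 + s ^+ 2 by rewrite sqr_sqrtr// ltW.
pose u := c / rho.
have cu : c = rho * u by rewrite mulrC divfK// gt_eqF.
have u2 : rho ^+ 2 * (1 - u ^+ 2) = s ^+ 2.
  by rewrite mulrBr mulr1 -exprMn -cu rho2; ring.
have u1 : u ^+ 2 <= 1.
  by rewrite -subr_ge0 -(pmulr_rge0 _ (exprn_gt0 2 rho0)) u2 sqr_ge0.
have uN : -1 <= u <= 1 by rewrite -ler_norml -(expr_le1 (n := 2))// -normrX ger0_norm// sqr_ge0.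
pose psi := acos u.
have cpsi : cos psi = u by rewrite acosK.
have spsi : rho * sin psi = s.
  rewrite sin_acos// -[in LHS](ger0_norm (ltW rho0)) -sqrtr_sqr -sqrtrM ?sqr_ge0// u2.
  by rewrite sqrtr_sqr ger0_norm.
have pE : p = polar rho (x + psi).
  have p1 : p.1 = rho * cos (x + psi).
    rewrite cosD cpsi mulrBr -[rho * (_ * u)]mulrCA -cu -[rho * (sin x * _)]mulrCA spsi.
    transitivity ((cos x ^+ 2 + sin x ^+ 2) * p.1); first by rewrite cos2Dsin2 mul1r.
    by rewrite /c /s /side; ring.
  have p2 : p.2 = rho * sin (x + psi).
    rewrite sinD cpsi mulrDr -[rho * (sin x * u)]mulrCA -cu -[rho * (cos x * _)]mulrCA spsi.
    transitivity ((cos x ^+ 2 + sin x ^+ 2) * p.2); first by rewrite cos2Dsin2 mul1r.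
    by rewrite /c /s /side; ring.
  by rewrite /polar -p1 -p2; case: (p).
exists rho, (x + psi); split => //; apply/andP; split.
  by rewrite lerDl acos_ge0.
(* An angle of at least y would lie in [y, y + pi], making [side y p] nonnegative. *)
rewrite ltNge; apply/negP => ypsi; move: sy; rewrite pE side_polar ltNge mulr_ge0//.
  exact: ltW.
have := acos_lepi uN; rewrite -/psi => psipi.
by apply: sin_ge0_pi; lra.
Qed.

(** * The region: polar representation and measurability *)

Section Region.
Variable r : R -> R.
Hypothesis rP : forall x, r (x + 2 * pi) = r x.
Hypothesis r0 : forall x, 0 < r x.
Hypothesis rC : continuous r.
Notation region := (polar_region r).

Lemma region_polar p x : region p ->
  exists rho phi, [/\ 0 <= rho <= r phi, x <= phi < x + 2 * pi & p = polar rho phi].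
Proof.
move=> [rho [phi [rho0 ->]]].
have [psi xpsi [rpsi ppsi]] := polar_reduction r rP x phi.
by exists rho, psi; rewrite rpsi ppsi.
Qed.

(** [cone_polar] does not bound the radius by [r] at the angle it finds. Here the representation
    given by membership in the region is used, its angle reduced to [x, x + 2 pi), and the signs of
    the sines place that angle in [x, y). *)
Lemma region_cone x y p : x <= y <= x + pi -> region p -> cone x y p ->
  exists rho phi, [/\ 0 < rho <= r phi, x <= phi < y & p = polar rho phi].
Proof.
move=> /andP[xy yx] /region_polar => /(_ x)[rho [phi [/andP[rho0 rhor] /andP[xphi phix] ->]]].
move=> [/=]; rewrite !side_polar => sx sy.
have {}rho0 : 0 < rho.
  by rewrite lt_neqAle rho0 andbT eq_sym; apply/eqP => rz; rewrite rz mul0r ltxx in sy.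
exists rho, phi; split => //; first exact/andP.
rewrite xphi /= ltNge; apply/negP => yphi.
move: sx sy; rewrite pmulr_rge0// pmulr_rlt0// => sx sy.
have [xpi|xpi] := leP (phi - x) pi.
  by move: sy; rewrite ltNge sin_ge0_pi//; lra.
have : 0 < sin (phi - x - pi) by apply: sin_gt0_pi; lra.
by rewrite sinB cospi sinpi mulr0 subr0 mulrN1 oppr_gt0 ltNge sx.
Qed.

(** The region is the image of the rectangle [0, 1] x [0, 2 pi] under a continuous map, hence
    compact and closed. *)
Lemma measurable_region : measurable (region : set plane).
Proof.
pose f (tp : R * R) : R * R := (tp.1 * r tp.2 * cos tp.2, tp.1 * r tp.2 * sin tp.2).
have cf : continuous f.
  have cr2 : continuous (fun tp : R * R => tp.1 * r tp.2).
    move=> tp; apply: cvgM; first exact: cvg_fst.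
    by apply: continuous_comp; [exact: cvg_snd|exact: rC].
  have c1 : continuous (fun tp : R * R => tp.1 * r tp.2 * cos tp.2).
    move=> tp; apply: cvgM; first exact: cr2.
    by apply: continuous_comp; [exact: cvg_snd|exact: continuous_cos].
  have c2 : continuous (fun tp : R * R => tp.1 * r tp.2 * sin tp.2).
    move=> tp; apply: cvgM; first exact: cr2.
    by apply: continuous_comp; [exact: cvg_snd|exact: continuous_sin].
  by move=> tp; exact: (@cvg_pair _ _ _ (nbhs tp) (nbhs (f tp).1) (nbhs (f tp).2) _ _ _ _ _ (c1 tp) (c2 tp)).
have -> : region = f @` (`[0, 1]%classic `*` `[0, 2 * pi]%classic).
  apply/seteqP; split => [p rp|].
    have [rho [phi [/andP[rho0 rhor] /andP[phi0 phi2] ->]]] := region_polar p 0 rp.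
    exists (rho / r phi, phi).
      split; rewrite /= in_itv/=.
        by rewrite divr_ge0 ?(ltW (r0 _))//= ler_pdivrMr// mul1r.
      by rewrite phi0 /= ltW// -[ltRHS]add0r.
    by rewrite /f /polar /= divfK// gt_eqF.
  move=> _ [[t phi] [/= t01 _] <-]; move: t01; rewrite in_itv/= => /andP[t0 t1].
  exists (t * r phi), phi; split => //.
  by rewrite mulr_ge0 ?(ltW (r0 _))//= ler_piMl// ltW.
apply: closed_measurable_plane; apply: compact_closed; first exact: norm_hausdorff.
apply: continuous_compact; first exact: continuous_subspaceT.
by apply: compact_setX; exact: segment_compact.
Qed.

End Region.
End Cones.

(** * The area of a sector *)

Section Sector.
Variable R : realType.
Notation plane := (measurableTypeR R * measurableTypeR R)%type.
Notation mu := (@leb2 R).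
Notation leb := (@lebesgue_measure R).

(** Summing the local bound over a fine equal subdivision gives F a b <= e (b - a) for every e. This
    takes the place of differentiation, both for the area of a sector and for integrals over double
    cones. *)
Lemma interval_fun_le0 (F : R -> R -> R) (a b : R) : a <= b ->
  (forall x y z, a <= x -> x <= y -> y <= z -> z <= b -> F x z = F x y + F y z) ->
  (forall e, 0 < e -> exists2 d, 0 < d &
     forall x y, a <= x -> x < y -> y <= b -> y - x < d -> F x y <= e * (y - x)) ->
  F a b <= 0.
Proof.
move=> ab Fadd Floc.
have F0 x : a <= x -> x <= b -> F x x = 0.
  by move=> ax xb; have := Fadd x x x ax (lexx _) (lexx _) xb; lra.
have [->|ab'] := eqVneq a b; first by rewrite F0.
have {ab'}ab' : a < b by rewrite lt_neqAle ab'.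
suff Fe e : 0 < e -> F a b <= e * (b - a).
  apply/ler_addgt0Pr => e e0; rewrite add0r.
  have ba : 0 < b - a by lra.
  by have := Fe (e / (b - a)) (divr_gt0 e0 ba); rewrite divfK// gt_eqF.
move=> e0; have [d d0 Fd] := Floc e e0.
(* With n + 1 pieces the mesh is strictly below d. *)
pose n := Num.truncn ((b - a) / d).
have nd : (b - a) / n.+1%:R < d.
  rewrite ltr_pdivrMr// mulrC -ltr_pdivrMr//.
  by rewrite /n; apply: truncnS_gt; rewrite divr_ge0// ?(ltW d0)//; lra.
pose s := (b - a) / n.+1%:R.
have s0 : 0 < s by rewrite divr_gt0//; lra.
have ns : n.+1%:R * s = b - a by rewrite mulrC divfK.
have step (k : nat) : (k <= n.+1)%N -> F a (a + k%:R * s) <= e * (k%:R * s).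
  elim: k => [|k IH] kn; first by rewrite mul0r addr0 mulr0 F0.
  have ks : k.+1%:R * s <= b - a by rewrite -ns ler_pM2r// ler_nat.
  have k0 : 0 <= k%:R * s by rewrite mulr_ge0// ltW.
  have kS : k.+1%:R * s = k%:R * s + s by rewrite -natr1 mulrDl mul1r.
  rewrite (Fadd _ (a + k%:R * s)); [|by lra..].
  have := IH (ltnW kn).
  have := Fd (a + k%:R * s) (a + k.+1%:R * s).
  have -> : a + k.+1%:R * s - (a + k%:R * s) = s by rewrite kS; ring.
  rewrite -/s in nd.
  move=> /(_ _ _ _ nd) H1 H2.
  have := H1 ltac:(lra) ltac:(lra) ltac:(lra).
  rewrite kS mulrDr; lra.
have := step n.+1 (leqnn _).
by rewrite ns addrC subrK.
Qed.

Lemma small_angle (e : R) : 0 < e -> exists2 d, 0 < d < pi / 2 &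
  forall x, 0 < x < d -> tan x <= (1 + e) * x /\ (1 - e) * x <= sin x * cos x.
Proof.
move=> e0.
have sinle (x : R) : 0 <= x -> sin x <= x.
  move=> x0; have [|c _ +] := @MVT_segment R sin cos 0 x x0 (fun y _ => is_derive_sin y).
    by apply: continuous_subspaceT; exact: continuous_sin.
  by rewrite sin0 !subr0 => ->; rewrite ler_piMl// cos_le1.
have singe (x : R) : 0 <= x <= pi / 2 -> x * cos x <= sin x.
  move=> /andP[x0 xpi]; have [|c + +] := @MVT_segment R sin cos 0 x x0 (fun y _ => is_derive_sin y).
    by apply: continuous_subspaceT; exact: continuous_sin.
  rewrite in_itv/= => /andP[c0 cx]; rewrite sin0 !subr0 => ->.
  rewrite mulrC ler_wpM2r//; have pi0 := pi_gt0 R.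
  by rewrite leNgt ltr_cos -?leNgt// in_itv/=; apply/andP; split; lra.
(* With 1 - cos x < e / (1 + e) one gets 1 <= (1 + e) cos x, for the tangent; with 1 - cos x < e / 2
   one gets 1 - e <= cos x ^ 2, for the product. *)
have e'0 : 0 < Num.min (e / (1 + e)) (e / 2).
  by rewrite lt_min !divr_gt0// addr_gt0.
have := @continuous_cos R 0 => /cvgrPdist_lt /(_ _ e'0).
rewrite cos0 => /nbhs_ballP[d /= d0 dcos].
have pi0 := pi_gt0 R.
exists (Num.min d (pi / 4)).
  by rewrite lt_min d0/=; rewrite divr_gt0//= gt_min; apply/orP; right; lra.
move=> x /andP[x0]; rewrite lt_min => /andP[xd xpi].
have := dcos x; rewrite /ball/= sub0r normrN gtr0_norm// => /(_ xd).
rewrite ger0_norm ?subr_ge0 ?cos_le1// lt_min => /andP[c1 c2].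
have c0 : 0 < cos x by apply: cos_gt0_pihalf; lra.
split.
  rewrite /tan ler_pdivrMr// -mulrA; apply: le_trans (sinle _ (ltW x0)) _.
  have : 1 <= (1 + e) * cos x.
    move: c1; rewrite ltr_pdivlMr; last lra.
    nra.
  nra.
have := singe x; have xx : 0 <= x <= pi / 2 by lra.
move=> /(_ xx) h.
apply: le_trans (_ : x * cos x * cos x <= _); last by rewrite ler_pM2r.
have : 1 - e <= cos x * cos x by nra.
nra.
Qed.


(** Rotating by the angle x turns the truncated cone into the right triangle of slope tan d. *)
Lemma leb2_cone_triangle (x d c : R) : 0 < d < pi / 2 -> 0 < c ->
  let T := [set p | cone _ x (x + d) p /\ cos x * p.1 + sin x * p.2 <= c] in
  measurable (T : set plane) /\ mu T = (tan d * (c ^+ 2 / 2))%:E.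
Proof.
move=> dpi c0 T.
have cd : 0 < cos d by apply: cos_gt0_pihalf; have := pi_gt0 R; lra.
have sd : 0 < sin d by apply: sin_gt0_pihalf.
have mT : measurable (T : set plane).
  have mf : measurable_fun setT (fun p : plane => cos x * p.1 + sin x * p.2).
    by apply: measurable_funD; apply: measurable_funM;
      first [exact: measurable_cst | exact: measurable_fst | exact: measurable_snd].
  have mH : measurable ((fun p : plane => cos x * p.1 + sin x * p.2) @^-1` `]-oo, c]).
    by rewrite -[X in measurable X]setTI; exact: mf.
  have -> : T = cone _ x (x + d) `&` (fun p : plane => cos x * p.1 + sin x * p.2) @^-1` `]-oo, c].
    by apply/seteqP; split => p [? ?]; split.
  by apply: measurableI => //; exact: measurable_cone.
split => //.
rewrite -(leb2_triangle _ (tan d))//; last by rewrite divr_ge0// ltW.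
rewrite -[LHS](leb2_rotation _ (cos x) (sin x) _ (cos2Dsin2 x) mT).
congr (mu _); apply/seteqP.
have rot (q : plane) : T (cos x * q.1 - sin x * q.2, sin x * q.1 + cos x * q.2) <->
    [/\ 0 <= q.2, q.2 < tan d * q.1 & q.1 <= c].
  rewrite /T /cone /side /= cosD sinD.
  have c2 := cos2Dsin2 x.
  have -> : cos x * (sin x * q.1 + cos x * q.2) - sin x * (cos x * q.1 - sin x * q.2) = q.2.
    by transitivity ((cos x ^+ 2 + sin x ^+ 2) * q.2); [ring|rewrite c2 mul1r].
  have -> : cos x * (cos x * q.1 - sin x * q.2) + sin x * (sin x * q.1 + cos x * q.2) = q.1.
    by transitivity ((cos x ^+ 2 + sin x ^+ 2) * q.1); [ring|rewrite c2 mul1r].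
  have -> : (cos x * cos d - sin x * sin d) * (sin x * q.1 + cos x * q.2) -
     (sin x * cos d + cos x * sin d) * (cos x * q.1 - sin x * q.2) = cos d * q.2 - sin d * q.1.
    transitivity ((cos x ^+ 2 + sin x ^+ 2) * (cos d * q.2 - sin d * q.1)).
      by ring.
    by rewrite c2 mul1r.
  rewrite subr_lt0 (_ : (cos d * q.2 < sin d * q.1) = (q.2 < tan d * q.1)); last first.
    by rewrite /tan mulrAC ltr_pdivlMr// mulrC.
  by split => [[[]]|[]].
by split => q /rot.
Qed.

(** Heine-Cantor, by the near-covering form of compactness; only x is confined to the segment. *)
Lemma segment_unif_continuous (f : R -> R) (a b e : R) : continuous f -> 0 < e ->
  exists2 d, 0 < d &
    forall x y, a <= x <= b -> `|x - y| < d -> `|f x - f y| < e.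
Proof.
move=> fC e0.
have [d [d0 Pd]] : exists d, 0 < d /\ `[a, b]%classic `<=`
    (fun x => forall y, `|x - y| < d -> `|f x - f y| < e).
  have Kc := @segment_compact R a b.
  rewrite compact_near_coveringP in Kc.
  suff C : forall x, `[a, b]%classic x -> \forall x' \near x & d \near (0 : R)^'+,
      forall y, `|x' - y| < d -> `|f x' - f y| < e.
    have H := Kc R (0^'+) (fun d x => forall y, `|x - y| < d -> `|f x - f y| < e) _ C.
    by have [d [d0 Pd]] := filter_ex (filterI (nbhs_right_gt (0 : R)) (H _)); exists d.
  move=> x _.
  have e20 : 0 < e / 2 by rewrite divr_gt0.
  have /cvgrPdist_lt/(_ _ e20)/nbhs_ballP[d /= d0 fd] := fC x.
  exists (ball x (d / 2), [set t | t < d / 2]).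
    by split => /=; [apply: nbhsx_ballx|apply: nbhs_right_lt]; rewrite divr_gt0.
  move=> [x' t] [/= xx' td] y xy.
  have fx' : `|f x - f x'| < e / 2.
    by apply: fd; move: xx'; rewrite /ball/= => /lt_trans; apply; lra.
  have fy : `|f x - f y| < e / 2.
    apply: fd; rewrite /ball/=; move: xx'; rewrite /ball/= => xx'.
    have -> : x - y = (x - x') + (x' - y) by ring.
    apply: le_lt_trans (ler_normD _ _) _; lra.
  have -> : f x' - f y = - (f x - f x') + (f x - f y) by ring.
  by apply: le_lt_trans (ler_normD _ _) _; rewrite normrN; lra.
by exists d => // x y xab; apply: Pd; rewrite /= in_itv.
Qed.

Section Region.
Variable r : R -> R.
Hypothesis rP : forall x, r (x + 2 * pi) = r x.
Hypothesis r0 : forall x, 0 < r x.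
Hypothesis rC : continuous r.
Notation region := (polar_region r).
Let m_region : measurable (region : set plane) := measurable_region R r rP r0 rC.

(** The sector lies between two right triangles with a leg along the ray of angle x. A point whose
    projection on that ray is at most m cos d has radius at most m, and a point of radius at most M
    has projection at most M. *)
Lemma sector_bounds (x d m M : R) : 0 < d < pi / 2 -> 0 < m ->
  (forall phi, x <= phi <= x + d -> m <= r phi <= M) ->
  ((tan d * ((m * cos d) ^+ 2 / 2))%:E <= mu (region `&` cone _ x (x + d)) <=
   (tan d * (M ^+ 2 / 2))%:E)%E.
Proof.
move=> dpi m0 rmM; have pi0 := pi_gt0 R.
have cd : 0 < cos d by apply: cos_gt0_pihalf; lra.
have M0 : 0 < M by have := rmM x ltac:(lra); lra.
have mc : 0 < m * cos d by rewrite mulr_gt0.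
have [mT1 <-] := leb2_cone_triangle x d _ dpi mc.
have [mT2 <-] := leb2_cone_triangle x d _ dpi M0.
have mS : measurable (region `&` cone _ x (x + d) : set plane).
  by apply: measurableI => //; exact: measurable_cone.
have coneP : x <= x + d <= x + pi by lra.
have proj rho phi : cos x * (polar R rho phi).1 + sin x * (polar R rho phi).2 = rho * cos (phi - x).
  by rewrite /polar /= cosB; ring.
apply/andP; split; apply: le_measure; rewrite ?inE//.
  move=> p [cp]; have [rho [phi [rho0 xphi pE]]] := cone_polar _ _ _ _ coneP cp.
  move: xphi => /andP[xphi phix].
  rewrite pE proj => rc; split; last by rewrite -pE.
  have cphi : cos d <= cos (phi - x).
    by rewrite leNgt ltr_cos -?leNgt ?in_itv/=; lra.
  have [/andP[mr _]] : m <= r phi <= M by apply: rmM; lra.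
  exists rho, phi; split => //; rewrite (ltW rho0)/=; apply: le_trans mr.
  by rewrite -(ler_pM2r cd); apply: le_trans rc; rewrite ler_pM2l.
move=> p [rp cp]; split => //.
have [rho [phi [/andP[rho0 rhor] /andP[xphi phix] ->]]] := region_cone _ r rP _ _ _ coneP rp cp.
rewrite proj; have /andP[_ rM] : m <= r phi <= M by apply: rmM; lra.
apply: le_trans rM; apply: le_trans rhor.
by rewrite ler_piMr ?cos_le1// ltW.
Qed.

Notation Ir := (fun x y => \int[leb]_(t in `[x, y]) (r t ^+ 2))%R.

Lemma sqr_integrable x y : leb.-integrable `[x, y] (EFin \o (fun t => r t ^+ 2)).
Proof.
apply: continuous_compact_integrable; first exact: segment_compact.
by apply: continuous_subspaceT => t; exact: (cvgM (rC t) (rC t)).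
Qed.

Lemma sqr_integral_additive x y z : x <= y -> y <= z -> Ir x z = Ir x y + Ir y z.
Proof.
move=> xy yz.
have H := @Rintegral_itvB R (fun t => r t ^+ 2) (BLeft x) (BRight z) y (sqr_integrable x z).
have {}H := H ltac:(by rewrite bnd_simp) ltac:(by rewrite bnd_simp).
rewrite Rintegral_itv_obnd_cbnd in H; last first.
  apply: (@integrableS _ _ _ leb `[y, z]) (sqr_integrable y z) => //.
  exact: subset_itv_oc_cc.
by rewrite -H; ring.
Qed.

Lemma sqr_integral_bounds x y m M : x <= y -> 0 <= m ->
  (forall phi, x <= phi <= y -> m <= r phi <= M) ->
  m ^+ 2 * (y - x) <= Ir x y <= M ^+ 2 * (y - x).
Proof.
move=> xy m0 rmM.
have cstE c : \int[leb]_(t in `[x, y]) c = c * (y - x).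
  rewrite Rintegral_cst//= lebesgue_measure_itv/= lte_fin; case: ltP => [|yx] //=.
  by have -> : y - x = 0 by lra.
have icst c : leb.-integrable `[x, y] (EFin \o (fun=> c)).
  apply: continuous_compact_integrable; first exact: segment_compact.
  by apply: continuous_subspaceT => t; exact: cvg_cst.
rewrite -!cstE; apply/andP; split; apply: le_Rintegral => //; try exact: sqr_integrable.
  move=> t /=; rewrite in_itv/= => /rmM/andP[mr _].
  by rewrite ler_pXn2r// nnegrE// ltW.
move=> t /=; rewrite in_itv/= => /rmM/andP[_ rM].
by rewrite ler_pXn2r// nnegrE ltW// (lt_le_trans (r0 t)).
Qed.


Hypothesis area1 : mu region = 1%E.

Lemma region_measure_le1 (X : set plane) : measurable X -> (mu (region `&` X) <= 1)%E.
Proof. by move=> mX; rewrite -area1; apply: le_measure; rewrite ?inE//; exact: measurableI. Qed.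

Lemma region_measure_fineK (X : set plane) : measurable X ->
  (fine (mu (region `&` X)))%:E = mu (region `&` X).
Proof.
move=> mX; rewrite fineK// ge0_fin_numE ?measure_ge0//.
by rewrite (le_lt_trans (region_measure_le1 _ mX))// ltry.
Qed.

Let S x y := fine (mu (region `&` cone _ x y)).

Lemma sector_additive x y z : x <= y -> y <= z -> z - x < pi -> S x z = S x y + S y z.
Proof.
move=> xy yz zx; have mc := measurable_cone R.
apply: EFin_inj; rewrite EFinD !region_measure_fineK// (cone_additive _ x y z)// setIUr.
rewrite [LHS]measureU//; [exact: measurableI|exact: measurableI|].
by rewrite setIACA cone_disjoint setI0.
Qed.

(** On a short interval [r] stays between m and M. Both the sector area and half the integral are
    then close to the interval length times any value between m^2 / 2 and M^2 / 2. *)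
Lemma sector_integral_close (a b e : R) : a <= b -> 0 < e -> exists2 d, 0 < d &
  forall x y, a <= x -> x < y -> y <= b -> y - x < d ->
    `|S x y - 2^-1 * Ir x y| <= e * (y - x).
Proof.
move=> ab e0.
have rsub : {within `[a, b], continuous r} by exact: continuous_subspaceT.
have [cm _ rm] := EVT_min ab rsub.
have [cM _ rM] := EVT_max ab rsub.
pose B := r cM; pose b0 := r cm.
have B0 : 0 < B by exact: r0.
have b00 : 0 < b0 by exact: r0.
(* The oscillation allowed for [r]: b0 / 2 keeps m = r x - eta positive, B gives M <= 2 B, and e /
   (4 B) gives M^2 - m^2 = 4 (r x) eta <= e. Likewise e' below is chosen so that e' M^2 <= e. *)
pose eta := Num.min (Num.min (b0 / 2) B) (e / (4 * B)).
have eta0 : 0 < eta by rewrite !lt_min !divr_gt0// ?B0// mulr_gt0.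
have etab : eta <= b0 / 2 by rewrite !ge_min lexx.
have etaB : eta <= B by rewrite !ge_min lexx orbT.
have etae : eta * (4 * B) <= e.
  by rewrite -ler_pdivlMr ?mulr_gt0// !ge_min lexx !orbT.
pose e' := e / (4 * B ^+ 2).
have e'0 : 0 < e' by rewrite divr_gt0// mulr_gt0// exprn_gt0.
have e'E : e' * (4 * B ^+ 2) = e by rewrite divfK// gt_eqF// mulr_gt0// exprn_gt0.
have [d1 d10 rd1] := segment_unif_continuous r a b eta rC eta0.
have [d2 /andP[d20 d2pi] sm] := small_angle e' e'0.
exists (Num.min d1 d2); first by rewrite lt_min d10.
move=> x y ax xy yb; rewrite lt_min => /andP[yxd1 yxd2].
have dpi : 0 < y - x < pi / 2 by lra.
have m0 : 0 < r x - eta.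
  have : b0 <= r x by apply: rm; rewrite in_itv/=; lra.
  lra.
have rxB : r x <= B by apply: rM; rewrite in_itv/=; lra.
have rmM phi : x <= phi <= y -> r x - eta <= r phi <= r x + eta.
  move=> xphi; have := rd1 x phi ltac:(lra).
  rewrite ltr_norml ltr_norml => /(_ ltac:(lra)); lra.
have yE : x + (y - x) = y by ring.
have := sector_bounds x (y - x) _ (r x + eta) dpi m0; rewrite yE => /(_ rmM).
rewrite -(region_measure_fineK _ (measurable_cone _ x y)) !lee_fin -/(S x y) => /andP[S1 S2].
have /andP[I1 I2] := sqr_integral_bounds x y _ _ (ltW xy) (ltW m0) rmM.
have [t1 t2] := sm (y - x) ltac:(lra).
move: S1 S2 I1 I2 t1 t2.
set m := r x - eta; set M := r x + eta; set d := y - x; set s := S x y; set J := Ir x y.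
have d0 : 0 < d by rewrite /d; lra.
have cd0 : 0 < cos d by apply: cos_gt0_pihalf; have := pi_gt0 R; rewrite /d; lra.
have -> : tan d * ((m * cos d) ^+ 2 / 2) = (sin d * cos d) * (m ^+ 2 / 2).
  by rewrite /tan; field; rewrite gt_eqF.
move=> S1 S2 I1 I2 t1 t2.
have MmE : M ^+ 2 - m ^+ 2 = 4 * (r x * eta) by rewrite /M /m; ring.
have Mm : M ^+ 2 - m ^+ 2 <= e.
  have : eta * (4 * r x) <= eta * (4 * B) by rewrite ler_pM2l// ler_pM2l.
  by rewrite MmE; lra.
have MB : M ^+ 2 <= 4 * B ^+ 2.
  have -> : 4 * B ^+ 2 = (2 * B) ^+ 2 by ring.
  by rewrite ler_pXn2r// ?nnegrE /M; lra.
have e'M : e' * M ^+ 2 <= e by rewrite -e'E ler_wpM2l// ltW.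
have e'm : e' * m ^+ 2 <= e.
  apply: le_trans e'M; apply: ler_wpM2l; first exact: ltW.
  by rewrite ler_pXn2r// ?nnegrE /M /m; lra.
have U1 : s <= (1 + e') * d * (M ^+ 2 / 2).
  apply: le_trans S2 _; apply: ler_wpM2r => //.
  by rewrite divr_ge0// exprn_ge0// /M; lra.
have L1 : (1 - e') * d * (m ^+ 2 / 2) <= s.
  apply: le_trans S1; apply: ler_wpM2r => //.
  by rewrite divr_ge0// exprn_ge0// ltW.
have E1 : e' * M ^+ 2 * d <= e * d by rewrite ler_pM2r.
have E2 : e' * m ^+ 2 * d <= e * d by rewrite ler_pM2r.
have E3 : (M ^+ 2 - m ^+ 2) * d <= e * d by rewrite ler_pM2r.
rewrite ler_norml; apply/andP; split; nra.
Qed.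

(** Area and half-integral are additive interval functions that agree to first order, so
    [interval_fun_le0] applies to their difference with either sign. *)
Lemma sector_area x y : x <= y -> y - x < pi ->
  mu (region `&` cone _ x y) = (2^-1 * Ir x y)%:E.
Proof.
move=> xy yx; rewrite -region_measure_fineK; last exact: measurable_cone.
congr (_%:E); rewrite -/(S x y); apply/eqP; rewrite eq_le -subr_le0 -[X in _ && X]subr_le0.
apply/andP; split.
  apply: (interval_fun_le0 (fun x y => S x y - 2^-1 * Ir x y)) => //.
    move=> u v w xu uv vw wy; rewrite (sector_additive u v w)//; last lra.
    by rewrite (sqr_integral_additive u v w)// mulrDr opprD addrACA.
  move=> e e0; have [d d0 H] := sector_integral_close _ _ _ xy e0; exists d => // u v xu uv vy vud.
  by apply: le_trans (H _ _ xu uv vy vud); exact: ler_norm.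
apply: (interval_fun_le0 (fun x y => 2^-1 * Ir x y - S x y)) => //.
  move=> u v w xu uv vw wy; rewrite (sector_additive u v w)//; last lra.
  by rewrite (sqr_integral_additive u v w)// mulrDr opprD addrACA.
move=> e e0; have [d d0 H] := sector_integral_close _ _ _ xy e0; exists d => // u v xu uv vy vud.
by apply: le_trans (H _ _ xu uv vy vud); rewrite distrC; exact: ler_norm.
Qed.

End Region.
End Sector.

(** * Half-plane areas and their variance *)

Section HalfPlanes.
Variable R : realType.
Notation plane := (measurableTypeR R * measurableTypeR R)%type.
Notation mu := (@leb2 R).
Notation leb := (@lebesgue_measure R).

(* cone (x + pi) (y + pi) is the reflection of cone x y through the origin. *)
Definition dcone (x y : R) : set (R * R) := cone R x y `|` cone R (x + pi) (y + pi).

Lemma measurable_dcone x y : measurable (dcone x y : set plane).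
Proof. by apply: measurableU; exact: measurable_cone. Qed.

Lemma dcone_additive x y z : x <= y -> y <= z -> z - x < pi ->
  dcone x z = dcone x y `|` dcone y z.
Proof.
move=> xy yz zx; rewrite /dcone (cone_additive _ x y z)//.
rewrite (cone_additive _ (x + pi) (y + pi) (z + pi)) ?lerD2r//; last first.
  by rewrite opprD addrACA subrr addr0.
by rewrite setUACA.
Qed.

(** By the sine rule the signs required by the two double cones are incompatible. The case z = x +
    pi is included because [dplane] uses it. *)
Lemma dcone_disjoint x y z : x <= y -> y < x + pi -> y <= z -> z <= x + pi ->
  dcone x y `&` dcone y z = set0.
Proof.
move=> xy yx yz zx; apply/seteqP; split => // p.
have [xyE|xy'] := eqVneq x y.
  rewrite -xyE => -[+ _]; rewrite /dcone /cone /= !sideDpi.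
  by move=> [[]|[]]; rewrite ?oppr_ge0 ?oppr_lt0 leNgt => /negbTE ->.
have {xy'}xy' : x < y by rewrite lt_neqAle xy'.
have s1 : 0 < sin (y - x) by apply: sin_gt0_pi; lra.
have s2 : 0 <= sin (z - y) by apply: sin_ge0_pi; lra.
have s3 : 0 <= sin (z - x) by apply: sin_ge0_pi; lra.
have := side_sine_rule _ x y z p.
rewrite /dcone /cone /= !sideDpi => E.
by move=> [[[a b]|[a b]] [[c d]|[c d]]]; nra.
Qed.

Section Region.
Variable r : R -> R.
Hypothesis rP : forall x, r (x + 2 * pi) = r x.
Hypothesis r0 : forall x, 0 < r x.
Hypothesis rC : continuous r.
Notation region := (polar_region r).
Hypothesis area1 : mu region = 1%E.
Let m_region : measurable (region : set plane) := measurable_region R r rP r0 rC.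
Notation Ir := (fun x y => \int[leb]_(t in `[x, y]) (r t ^+ 2))%R.

(** * Area of the half-regions as a function of the angle *)

Definition halfplane (x : R) : set (R * R) := [set p | 0 < side R x p].
Let m_half x : measurable (halfplane x : set plane) := measurable_side_gt0 R x.

Lemma measurable_line x : measurable ([set p | side R x p = 0] : set plane).
Proof.
rewrite (_ : [set p | _] = side R x @^-1` [set 0]); last by [].
by rewrite -[X in measurable X]setTI; apply: measurable_fun_side.
Qed.

Lemma region_line0 x : mu (region `&` [set p | side R x p = 0]) = 0%E.
Proof.
apply/eqP; rewrite eq_le measure_ge0 andbT -(side_line R x).
by apply: le_measure; rewrite ?inE//; [apply: measurableI => //|]; exact: measurable_line.
Qed.

Lemma halfplane_area x : mu (region `&` halfplane x) = (2^-1 * Ir x (x + pi))%:E.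
Proof.
(* The half-plane is cut at the right angle m, since [sector_area] covers angles below pi only.
   Adding the null line [L] to both sides absorbs the boundary ray contained in the first cone. *)
have pi0 := pi_gt0 R.
pose L : set plane := [set p | side R x p = 0]; pose m := x + pi / 2.
have mL : measurable (region `&` L : set plane) by apply: measurableI => //; exact: measurable_line.
have mc1 : measurable (region `&` cone R x m : set plane) by apply: measurableI => //; exact: measurable_cone.
have mc2 : measurable (region `&` cone R m (x + pi) : set plane) by apply: measurableI => //; exact: measurable_cone.
have mh : measurable (region `&` halfplane x : set plane) by apply: measurableI => //; exact: m_half.
rewrite -[LHS](measureU0 mh mL (region_line0 x)).
rewrite (_ : _ `|` _ = (region `&` cone R x m) `|` (region `&` cone R m (x + pi)) `|` (region `&` L)); last first.
  rewrite -!setIUr; congr (_ `&` _); apply/seteqP; split => p; rewrite /halfplane /L /cone /= sideDpi oppr_lt0.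
    move=> [sx|]; last by right.
    by left; have [sm|sm] := ltP (side R m p) 0; [left|right] => //; rewrite ltW.
  move=> [[[sx sm]|[sm sx]]|]; [|by left|by right].
  by move: sx; rewrite le_eqVlt => /predU1P[->|]; [right|left].
have mc : measurable ((region `&` cone R x m) `|` (region `&` cone R m (x + pi)) : set plane) by exact: measurableU.
rewrite (measureU0 mc mL (region_line0 x)).
rewrite measureU//; last by rewrite setIACA cone_disjoint setI0.
rewrite [X in (X + _)%E](sector_area _ r rP r0 rC area1); [|rewrite /m; lra..].
rewrite [X in (_ + X)%E](sector_area _ r rP r0 rC area1); [|rewrite /m; lra..].
rewrite -EFinD; congr (_%:E).
by rewrite (sqr_integral_additive _ r rC x m (x + pi)); [ring|rewrite /m; lra..].
Qed.

(* Stated as an existence and closed by Qed so that half_area does not unfold to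
   a measure when ring and lra compare their atoms. *)
Lemma half_area_exists :
  {k : R -> R | forall x, (k x)%:E = mu (region `&` halfplane x)}.
Proof.
by exists (fun x => fine (mu (region `&` halfplane x))) => x; rewrite halfplane_area.
Qed.

Definition half_area : R -> R := sval half_area_exists.

Lemma half_areaE x : (half_area x)%:E = mu (region `&` halfplane x).
Proof. exact: (svalP half_area_exists). Qed.

Lemma half_area_ge0 x : 0 <= half_area x.
Proof. by rewrite -lee_fin half_areaE measure_ge0. Qed.

(** Opposite open half-planes fill the region up to a null line. *)
Lemma half_areaDpi x : half_area (x + pi) = 1 - half_area x.
Proof.
have EF : ((half_area x)%:E + (half_area (x + pi))%:E = 1 :> \bar R)%E -> half_area (x + pi) = 1 - half_area x.
  rewrite -EFinD; move: (half_area x) (half_area (x + pi)) => a b [ab].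
  by rewrite -ab addrC addKr.
apply: EF.
have mL : measurable (region `&` [set p | side R x p = 0] : set plane).
  by apply: measurableI => //; exact: measurable_line.
have mh y : measurable (region `&` halfplane y : set plane) by apply: measurableI => //; exact: m_half.
have mhh : measurable ((region `&` halfplane x) `|` (region `&` halfplane (x + pi)) : set plane) by exact: measurableU.
rewrite (half_areaE x) (half_areaE (x + pi)) -area1 -[LHS]measureU//; last first.
  by apply/seteqP; split => // p [[_ +] [_]]; rewrite /halfplane /= sideDpi oppr_gt0; lra.
rewrite -[LHS](measureU0 mhh mL (region_line0 x)); congr (mu _).
rewrite -!setIUr; apply/seteqP; split => [p []//|p rp]; split => //.
rewrite /halfplane /= sideDpi oppr_gt0.
by case: (ltgtP (side R x p) 0) => ?; [left; right|left; left|right].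
Qed.

Lemma half_areaD2pi x : half_area (x + 2 * pi) = half_area x.
Proof. by rewrite mulr_natl mulr2n addrA !half_areaDpi; ring. Qed.

(** The half-planes at x and y differ only inside the double cone, apart from the null line of angle
    y. *)
Lemma half_area_dcone x y : `|half_area y - half_area x| <= fine (mu (region `&` dcone x y)).
Proof.
have mh z : measurable (region `&` halfplane z : set plane) by apply: measurableI => //; exact: m_half.
have md : measurable (region `&` dcone x y : set plane) by apply: measurableI => //; exact: measurable_dcone.
have mL : measurable (region `&` [set p | side R y p = 0] : set plane).
  by apply: measurableI => //; exact: measurable_line.
have mdK := region_measure_fineK _ r rP r0 rC area1 _ (measurable_dcone x y).
have le1 : ((half_area x)%:E <= (half_area y)%:E + mu (region `&` dcone x y))%E.
  rewrite (half_areaE x) (half_areaE y).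
  have mhd : measurable ((region `&` halfplane y) `|` (region `&` dcone x y) : set plane) by exact: measurableU.
  apply: le_trans (measureU2 _ (mh y) md).
  rewrite -[leRHS](measureU0 mhd mL (region_line0 y)).
  apply: le_measure; rewrite ?inE//; first exact: measurableU.
  move=> p [rp hp]; have [sy|sy|sy] := ltgtP (side R y p) 0.
  - by left; right; split => //; left; split => //; exact: ltW.
  - by left; left.
  - by right.
have le2 : ((half_area y)%:E <= (half_area x)%:E + mu (region `&` dcone x y))%E.
  rewrite (half_areaE x) (half_areaE y).
  apply: le_trans (measureU2 _ (mh x) md).
  apply: le_measure; rewrite ?inE//; first exact: measurableU.
  move=> p [rp hp]; have [sx|sx] := ltP 0 (side R x p); first by left.
  by right; split => //; right; rewrite /cone /= !sideDpi oppr_ge0 oppr_lt0.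
move: le1 le2; rewrite -mdK; move: (fine (mu _)) (half_area x) (half_area y) => c a b.
rewrite -!EFinD !lee_fin => le1 le2.
by rewrite /= ler_norml; apply/andP; split; lra.
Qed.

(** The double cone consists of two sectors, each of area at most (max r)^2 (y - x) / 2, so L = (max
    r)^2 works. *)
Lemma half_area_lipschitz : exists2 L, 0 < L & forall x y, x <= y -> y - x < pi ->
  `|half_area y - half_area x| <= L * (y - x).
Proof.
have pi0 := pi_gt0 R.
have [M _ rM] := @EVT_max R r 0 (2 * pi) ltac:(lra) ltac:(exact: continuous_subspaceT).
have rle x : r x <= r M.
  have [psi xpsi [<- _]] := polar_reduction _ r rP 0 x.
  by apply: rM; rewrite in_itv/=; lra.
have Ib x y : x <= y -> Ir x y <= r M ^+ 2 * (y - x).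
  move=> xy; have := sqr_integral_bounds _ r r0 rC x y 0 (r M) xy (lexx 0).
  by move=> /(_ _)/andP[phi _|//]; rewrite rle ltW.
exists (r M ^+ 2); first exact: exprn_gt0.
move=> x y xy yx; apply: le_trans (half_area_dcone x y) _.
rewrite -lee_fin (region_measure_fineK _ r rP r0 rC area1 _ (measurable_dcone x y)) /dcone setIUr.
have mc u v : measurable (region `&` cone R u v : set plane) by apply: measurableI => //; exact: measurable_cone.
apply: le_trans (measureU2 _ (mc _ _) (mc _ _)) _.
rewrite [X in (X + _)%E](sector_area _ r rP r0 rC area1)//.
rewrite [X in (_ + X)%E](sector_area _ r rP r0 rC area1); [|lra..].
have := Ib x y xy; have := Ib (x + pi) (y + pi) ltac:(lra).
have -> : y + pi - (x + pi) = y - x by ring.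
by rewrite -EFinD lee_fin; lra.
Qed.


(** * Integrals of even weights over double cones *)

Section DconeIntegral.
Variable K : plane -> R.
Hypothesis mK : measurable_fun setT K.
Hypothesis left_area_polar : forall rho phi, 0 < rho -> region (polar R rho phi) ->
  K (polar R rho phi) = half_area phi.

Lemma dcone_K x y p : x <= y <= x + pi -> region p -> dcone x y p ->
  exists2 phi, x <= phi < y & K p = half_area phi \/ K p = 1 - half_area phi.
Proof.
move=> xy rp [|] cp.
  have [rho [phi [/andP[rho0 rhor] xphi pE]]] := region_cone _ r rP _ _ _ xy rp cp.
  by exists phi => //; left; rewrite pE left_area_polar// -pE.
have xy' : x + pi <= y + pi <= x + pi + pi by lra.
have [rho [phi [/andP[rho0 rhor] xphi pE]]] := region_cone _ r rP _ _ _ xy' rp cp.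
exists (phi - pi); first lra.
by right; rewrite -half_areaDpi subrK pE left_area_polar// -pE.
Qed.

(** An even weight w with values in [0, 1] on [- d, d], with C as Lipschitz constant there. [W_inc]
    is the integrated form of W' = w, with its second-order error made explicit. *)
Variables (w W : R -> R) (d C : R).
Hypothesis mw : measurable_fun setT w.
Hypothesis wN : forall u, w (- u) = w u.
Hypothesis w01 : forall u, `|u| <= d -> 0 <= w u <= 1.
Hypothesis C0 : 0 <= C.
Hypothesis w_lip : forall u z, `|u| <= d -> `|z| <= d -> w u - C * `|z - u| <= w z.
Hypothesis W_inc : forall u v, `|u| <= d -> `|v| <= d ->
  W v - W u <= (w u + C * `|v - u|) * `|v - u|.
Hypothesis half_area_le_d : forall x, `|half_area x - 2^-1| <= d.

Let f (p : plane) : \bar R := (w (K p - 2^-1))%:E.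

(** On opposite rays K - 1/2 takes opposite values, which the even weight does not distinguish. *)
Lemma dcone_weight x y p : x <= y <= x + pi -> region p -> dcone x y p ->
  exists2 phi, x <= phi < y & f p = (w (half_area phi - 2^-1))%:E.
Proof.
move=> xy rp cp; have [phi xphi [|] E] := dcone_K x y p xy rp cp; exists phi => //.
  by rewrite /f E.
by rewrite /f E -wN; congr (w _)%:E; field.
Qed.

Lemma measurable_weight : measurable_fun setT f.
Proof.
apply/measurable_EFinP; apply: (measurableT_comp mw).
exact: measurable_funB.
Qed.

Let m_dcone x y : measurable (region `&` dcone x y : set plane).
Proof. by apply: measurableI => //; exact: measurable_dcone. Qed.

Lemma weight_ge0 x y p : x <= y <= x + pi -> (region `&` dcone x y) p -> (0 <= f p)%E.
Proof.
move=> xy [rp cp]; have [phi _ ->] := dcone_weight x y p xy rp cp.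
by rewrite lee_fin; have /andP[] := w01 _ (half_area_le_d phi).
Qed.

(** The integral is finite because the weight is at most 1 there and the region has area 1. Like
    [half_area], it is packaged as an opaque real function. *)
Lemma dcone_integral_exists : {Th : R -> R -> R | forall x y, x <= y <= x + pi ->
  ((Th x y)%:E = \int[mu]_(p in region `&` dcone x y) f p)%E}.
Proof.
exists (fun x y => fine (\int[mu]_(p in region `&` dcone x y) f p)%E) => x y xy.
rewrite fineK// ge0_fin_numE; last first.
  by apply: integral_ge0 => p; exact: weight_ge0.
apply: (@le_lt_trans _ _ (\int[mu]_(p in region `&` dcone x y) (cst 1%E p))%E).
  apply: ge0_le_integral => //.
  - by move=> p; exact: weight_ge0.
  - by apply: measurable_funTS; exact: measurable_weight.
  - move=> p [rp cp]; have [phi _ ->] := dcone_weight x y p xy rp cp.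
    by rewrite lee_fin; have /andP[] := w01 _ (half_area_le_d phi).
rewrite integral_cst// mul1e; apply: le_lt_trans (ltry 1).
by apply: (region_measure_le1 _ r rP r0 rC area1); exact: measurable_dcone.
Qed.

Let Th : R -> R -> R := sval dcone_integral_exists.
Let ThK := svalP dcone_integral_exists.

Lemma dcone_integral_additive x y z : x <= y -> y <= z -> z - x < pi -> Th x z = Th x y + Th y z.
Proof.
move=> xy yz zx; apply: EFin_inj; rewrite EFinD !ThK; [|lra..].
rewrite (dcone_additive x y z)// setIUr ge0_integral_setU//.
- by apply: measurable_funTS; exact: measurable_weight.
- by move=> p [] pc; [apply: (weight_ge0 x y)|apply: (weight_ge0 y z)] => //; lra.
- apply/disj_setPRL => p [_ cp] [_ cp'].
  suff : (dcone x y `&` dcone y z) p by rewrite dcone_disjoint//; lra.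
  by split.
Qed.

(** On a short [u, v] let s and t be the values of [half_area] minus 1/2 at the ends. The weight is
    nearly w s and the double cone has area at least |t - s|, so the integral is at least w s |t -
    s| up to second order, while W t - W s is at most that up to second order. [interval_fun_le0]
    then sums these comparisons. *)
Lemma integral_dcone_ge x y : x <= y -> y - x < pi ->
  ((W (half_area y - 2^-1) - W (half_area x - 2^-1))%:E <=
   \int[mu]_(p in region `&` dcone x y) (w (K p - 2^-1))%:E)%E.
Proof.
move=> xy yx; rewrite -/f -ThK; last lra.
rewrite lee_fin -subr_le0.
apply: (interval_fun_le0 _ (fun x y => W (half_area y - 2^-1) - W (half_area x - 2^-1) - Th x y)) => //.
  move=> u v z xu uv vz zy; rewrite (dcone_integral_additive u v z)//; [ring|lra].
move=> e e0; have [L L0 lipL] := half_area_lipschitz.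
(* The second-order errors add up to 2 C L^2 (v - u)^2: one share from the variation of w, one from
   [W_inc]. The summand 1 makes M positive even when C = 0. *)
pose M := 2 * C * L ^+ 2 + 1.
have M0 : 0 < M by rewrite ltr_wpDl// mulr_ge0 ?exprn_ge0 ?mulr_ge0// ltW.
exists (e / M); first exact: divr_gt0.
move=> u v xu uv vy vue.
have uv' : u <= v <= u + pi by lra.
set s := half_area u - 2^-1; set t := half_area v - 2^-1.
have st : `|t - s| <= L * (v - u).
  have -> : t - s = half_area v - half_area u by rewrite /t /s; ring.
  by apply: lipL; lra.
pose m := fine (mu (region `&` dcone u v)).
have stm : `|t - s| <= m.
  have -> : t - s = half_area v - half_area u by rewrite /t /s; ring.
  exact: half_area_dcone.
(* A lower bound of the weight on the double cone, cut off at 0 so that multiplying it by |t - s| <=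
   m preserves the inequality. *)
pose c := Num.max 0 (w s - C * (L * (v - u))).
have c0 : 0 <= c by rewrite le_max lexx.
have cw : w s - C * (L * (v - u)) <= c by rewrite le_max lexx orbT.
have Thc : c * m <= Th u v.
  rewrite -lee_fin EFinM ThK// /m (region_measure_fineK _ r rP r0 rC area1 _ (measurable_dcone u v)).
  rewrite -integral_cst//; apply: ge0_le_integral => //.
  - by apply: measurable_funTS; exact: measurable_weight.
  - move=> p [rp cp]; have [phi phiuv ->] := dcone_weight u v p uv' rp cp.
    rewrite lee_fin ge_max; have /andP[-> _] /= := w01 _ (half_area_le_d phi).
    apply: le_trans (w_lip _ _ (half_area_le_d u) (half_area_le_d phi)); rewrite -/s lerD2l lerN2.
    apply: ler_wpM2l => //.
    have -> : half_area phi - 2^-1 - s = half_area phi - half_area u by rewrite /s; ring.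
    apply: le_trans (lipL _ _ _ _) _; [lra|lra|].
    by rewrite ler_pM2l//; lra.
have Wst := W_inc s t (half_area_le_d u) (half_area_le_d v).
have n0 : 0 <= `|t - s| by exact: normr_ge0.
have H1 : c * `|t - s| <= Th u v by apply: le_trans Thc; apply: ler_wpM2l.
have H2 : W t - W s <= (c + 2 * (C * (L * (v - u)))) * `|t - s|.
  apply: le_trans Wst _; apply: ler_wpM2r => //.
  have : C * `|t - s| <= C * (L * (v - u)) by apply: ler_wpM2l.
  lra.
have CL0 : 0 <= 2 * (C * (L * (v - u))).
  by rewrite !mulr_ge0// ?(ltW L0)//; lra.
have H3 : 2 * (C * (L * (v - u))) * `|t - s| <= 2 * (C * (L * (v - u))) * (L * (v - u)).
  exact: ler_wpM2l.
have H4 : 2 * (C * (L * (v - u))) * (L * (v - u)) <= M * (v - u) * (v - u).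
  have -> : 2 * (C * (L * (v - u))) * (L * (v - u)) = (M - 1) * (v - u) * (v - u).
    by rewrite /M; ring.
  by rewrite -!mulrA ler_wpM2r ?mulr_ge0//; lra.
have H5 : M * (v - u) * (v - u) <= e * (v - u).
  by rewrite ler_pM2r ?subr_gt0// mulrC -ler_pdivlMr// ltW.
lra.
Qed.


(* The whole region up to a null set, cut in two because dcone is only
   additive on intervals shorter than pi. *)
Definition dplane (x : R) : set plane :=
  (region `&` dcone x (x + pi / 2)) `|` (region `&` dcone (x + pi / 2) (x + pi)).

Lemma measurable_dplane x : measurable (dplane x).
Proof. exact: measurableU. Qed.

Lemma dplane_weight_ge0 x p : dplane x p -> (0 <= f p)%E.
Proof. by have := pi_gt0 R; move=> pi0 [] /weight_ge0; apply; lra. Qed.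

Lemma integral_dplane_ge x :
  ((W (half_area (x + pi) - 2^-1) - W (half_area x - 2^-1))%:E <=
   \int[mu]_(p in dplane x) (w (K p - 2^-1))%:E)%E.
Proof.
have pi0 := pi_gt0 R.
rewrite -/f /dplane ge0_integral_setU//.
- have -> : W (half_area (x + pi) - 2^-1) - W (half_area x - 2^-1) =
     (W (half_area (x + pi / 2) - 2^-1) - W (half_area x - 2^-1)) +
     (W (half_area (x + pi) - 2^-1) - W (half_area (x + pi / 2) - 2^-1)) by ring.
  by rewrite EFinD; apply: leeD; apply: integral_dcone_ge; lra.
- by apply: measurable_funTS; exact: measurable_weight.
- by move=> p /dplane_weight_ge0.
- apply/disj_setPRL => p [_ cp] [_ cp'].
  suff : (dcone x (x + pi / 2) `&` dcone (x + pi / 2) (x + pi)) p.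
    by rewrite dcone_disjoint//; lra.
  by split.
Qed.

End DconeIntegral.

(** * Bounds for the variance *)

Section Variance.
Variable K : plane -> R.
Hypothesis mK : measurable_fun setT K.
Hypothesis left_area_polar : forall rho phi, 0 < rho -> region (polar R rho phi) ->
  K (polar R rho phi) = half_area phi.

Let v (p : plane) : \bar R := ((K p - 2^-1) ^+ 2)%:E.
Let mv : measurable_fun setT v.
Proof. by apply/measurable_EFinP; apply: measurable_funX; exact: measurable_funB. Qed.
Let v0 p : (0 <= v p)%E. Proof. by rewrite lee_fin sqr_ge0. Qed.

Lemma dplane_sub x : dplane x `<=` region.
Proof. by move=> p [] []. Qed.

(** The signs of [side] at x and x + pi / 2 place each point of the region off the null line of
    angle x in one of the two double cones. *)
Lemma integral_dplane x :
  (\int[mu]_(p in region) v p = \int[mu]_(p in dplane x) v p)%E.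
Proof.
pose L : set plane := [set p | side R x p = 0].
have mL : measurable L by exact: measurable_line.
have md := measurable_dplane x.
apply/eqP; rewrite eq_le; apply/andP; split; last first.
  apply: ge0_subset_integral => //; last exact: dplane_sub.
  by apply: measurable_funTS; exact: mv.
rewrite (@ge0_negligible_integral _ _ _ mu region L)//; last 2 first.
- by apply: measurable_funTS; exact: mv.
- exact: side_line.
apply: ge0_subset_integral => //.
- exact: measurableD.
- by apply: measurable_funTS; exact: mv.
- move=> p [rp Lp]; rewrite /dplane -setIUr; split => //.
  rewrite /dcone /cone /= !sideDpi !opprK.
  have := Lp; rewrite /L /=.
  have [sx|sx|//] := ltgtP (side R x p) 0 => _.
    have [sm|sm] := ltP 0 (side R (x + pi / 2) p).
      by left; right; rewrite oppr_ge0 oppr_lt0 (ltW sx).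
    by right; right; rewrite oppr_ge0.
  have [sm|sm] := ltP (side R (x + pi / 2) p) 0.
    by left; left.
  by right; left; rewrite ?oppr_lt0.
Qed.

(** [integral_dplane_ge] is applied at t0, where [half_area] minus 1/2 goes from - d to d. The
    weight u^2 gives the lower bound; the weight d^2 - u^2, whose integral together with V is at
    most d^2, gives the upper bound. *)
Lemma variance_bounds (h t0 V : R) : half_area t0 = h -> (forall x, h <= half_area x) ->
  (\int[mu]_(p in region) v p = V%:E)%E ->
  2 / 3 * (2^-1 - h) ^+ 3 <= V <= (2^-1 - h) ^+ 2 - 4 / 3 * (2^-1 - h) ^+ 3.
Proof.
move=> kt0 hk VE; pose d := 2^-1 - h; rewrite -/d.
have h0 : 0 <= h by rewrite -kt0 half_area_ge0.
(* Minimality of h at x + pi bounds [half_area x] above by 1 - h. *)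
have half_area_le_d x : `|half_area x - 2^-1| <= d.
  have := hk x; have := hk (x + pi); rewrite half_areaDpi ler_norml /d => ? ?.
  by apply/andP; split; lra.
have d0 : 0 <= d by apply: le_trans (half_area_le_d 0).
have d1 : d <= 2^-1 by rewrite /d; lra.
have d2 : d ^+ 2 <= 1 by rewrite expr_le1//; lra.
have ktpi : half_area (t0 + pi) - 2^-1 = d by rewrite half_areaDpi kt0 /d; field.
have kt : half_area t0 - 2^-1 = - d by rewrite kt0 /d; ring.
have sq_le (u : R) : `|u| <= d -> u ^+ 2 <= d ^+ 2.
  by rewrite ler_norml => /andP[? ?]; nra.
(* As |u + z| <= 2 d <= 1, both weights have Lipschitz constant C = 1. *)
have mid (u z : R) : `|u| <= d -> `|z| <= d -> u ^+ 2 - z ^+ 2 <= `|z - u|.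
  rewrite !ler_norml => /andP[? ?] /andP[? ?].
  have := normr_ge0 (z - u); have := ler_norm (z - u); have := ler_norm (u - z).
  rewrite distrC; nra.
have mq : measurable_fun setT (fun u : R => u ^+ 2) by apply: measurable_funX.
rewrite (integral_dplane t0) in VE.
(* The difference quotient of u^3 / 3 between u and s is compared with its derivative u^2; this
   yields [W_inc] for both weights. *)
have cub (u s : R) : `|u| <= d -> `|s| <= d ->
   `|(s ^+ 2 + s * u + u ^+ 2) / 3 - u ^+ 2| <= `|s - u|.
  rewrite !ler_norml => /andP[? ?] /andP[? ?].
  have := normr_ge0 (s - u); have := ler_norm (s - u); have := ler_norm (u - s).
  rewrite distrC => ? ? ?; apply/andP; split; nra.
have low := @integral_dplane_ge K mK left_area_polar (fun u => u ^+ 2) (fun u => u ^+ 3 / 3) d 1 mq.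
have {}low := low (@sqrrN _) _ ler01 _ _ half_area_le_d t0.
have Vlow : 2 / 3 * d ^+ 3 <= V.
  rewrite -lee_fin -VE; apply: le_trans (low _ _ _).
  - by rewrite ktpi kt lee_fin; lra.
  - by move=> u ud; rewrite sqr_ge0/= (le_trans (sq_le _ ud)).
  - by move=> u z ud zd; rewrite mul1r; have := mid u z ud zd; lra.
  - move=> u s ud sd; rewrite mul1r.
    have -> : s ^+ 3 / 3 - u ^+ 3 / 3 = (s - u) * ((s ^+ 2 + s * u + u ^+ 2) / 3) by field.
    have := cub u s ud sd; rewrite ler_norml => /andP[_ q1].
    have q0 : 0 <= (s ^+ 2 + s * u + u ^+ 2) / 3 by rewrite divr_ge0//; nra.
    apply: (@le_trans _ _ (`|s - u| * ((s ^+ 2 + s * u + u ^+ 2) / 3))).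
      by apply: ler_wpM2r => //; exact: ler_norm.
    by rewrite mulrC; apply: ler_wpM2r => //; lra.
have mq' : measurable_fun setT (fun u : R => d ^+ 2 - u ^+ 2) by apply: measurable_funB.
have w01 u : `|u| <= d -> 0 <= d ^+ 2 - u ^+ 2 <= 1.
  by move=> ud; have := sq_le _ ud; have := sqr_ge0 u; move=> ? ?; apply/andP; split; lra.
have wN (u : R) : d ^+ 2 - (- u) ^+ 2 = d ^+ 2 - u ^+ 2 by rewrite sqrrN.
have up := @integral_dplane_ge K mK left_area_polar (fun u => d ^+ 2 - u ^+ 2) (fun u => d ^+ 2 * u - u ^+ 3 / 3) d 1 mq' wN w01 ler01 _ _ half_area_le_d t0.
have w0 := @dplane_weight_ge0 K left_area_polar (fun u => d ^+ 2 - u ^+ 2) d wN w01 half_area_le_d t0.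
have Dlow : ((4 / 3 * d ^+ 3)%:E <= \int[mu]_(p in dplane t0) (d ^+ 2 - (K p - 2^-1) ^+ 2)%:E)%E.
  apply: le_trans (up _ _).
  - by rewrite ktpi kt lee_fin; lra.
  - by move=> u z ud zd; rewrite mul1r; have := mid z u zd ud; rewrite distrC; lra.
  - move=> u s ud sd; rewrite mul1r.
    have -> : d ^+ 2 * s - s ^+ 3 / 3 - (d ^+ 2 * u - u ^+ 3 / 3) =
      (s - u) * (d ^+ 2 - (s ^+ 2 + s * u + u ^+ 2) / 3) by field.
    have := cub u s ud sd; rewrite ler_norml => /andP[q1 _].
    have q0 : 0 <= d ^+ 2 - (s ^+ 2 + s * u + u ^+ 2) / 3.
      have := sq_le _ ud; have := sq_le _ sd; have := sqr_ge0 (s - u); rewrite sqrrB; lra.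
    apply: (@le_trans _ _ (`|s - u| * (d ^+ 2 - (s ^+ 2 + s * u + u ^+ 2) / 3))).
      by apply: ler_wpM2r => //; exact: ler_norm.
    by rewrite mulrC; apply: ler_wpM2r => //; lra.
have tot : (V%:E + \int[mu]_(p in dplane t0) (d ^+ 2 - (K p - 2^-1) ^+ 2)%:E <= (d ^+ 2)%:E)%E.
  rewrite -VE -ge0_integralD//.
  - apply: (@le_trans _ _ (\int[mu]_(p in dplane t0) (cst (d ^+ 2)%:E p))%E).
      rewrite le_eqVlt; apply/orP; left; apply/eqP; apply: eq_integral => p _; rewrite /v -EFinD; congr (_%:E) => /=; ring.
    rewrite integral_cst; last exact: measurable_dplane.
    rewrite -[leRHS]mule1; apply: lee_wpmul2l; first by rewrite lee_fin sqr_ge0.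
    rewrite -area1; apply: le_measure; rewrite ?inE//; first exact: measurable_dplane.
    exact: dplane_sub.
  - exact: measurable_dplane.
  - by apply: measurable_funTS; exact: mv.
  - apply: measurable_funTS; apply/measurable_EFinP.
    by apply: (measurableT_comp mq'); exact: measurable_funB.
rewrite Vlow /=.
have := le_trans (leeD (lexx V%:E) Dlow) tot.
by rewrite -EFinD lee_fin; lra.
Qed.

End Variance.
End Region.
End HalfPlanes.

(** * Triangles containing the origin *)

Section Triangle.
Variable R : realType.
Implicit Types A B C : R * R.

Definition det2 A B : R := A.1 * B.2 - A.2 * B.1.
Definition dot2 A B : R := A.1 * B.1 + A.2 * B.2.

Lemma det2C A B : det2 B A = - det2 A B.
Proof. by rewrite /det2; ring. Qed.

Lemma dot2_ge0 A : 0 <= dot2 A A.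
Proof. by rewrite addr_ge0// -expr2 sqr_ge0. Qed.

Lemma dot2_eq0 A : dot2 A A = 0 -> A.1 = 0 /\ A.2 = 0.
Proof.
move=> /eqP; rewrite /dot2 paddr_eq0 -?expr2 ?sqr_ge0// !sqrf_eq0.
by move=> /andP[/eqP ? /eqP ?].
Qed.

(** Barycentric coordinates of the origin are proportional to the three determinants, which
    therefore cannot have strictly opposite signs: b = c = 0 and a = 1 would follow, hence s3 =
    0. *)
Lemma barycentric_sign (a b c s1 s2 s3 : R) : 0 <= a -> 0 <= b -> 0 <= c -> a + b + c = 1 ->
  b * s3 = c * s2 -> c * s1 = a * s3 -> 0 < s3 -> s2 < 0 -> False.
Proof.
move=> a0 b0 c0 abc e1 e2 s30 s20.
have b0' : b = 0 by nra.
have c0' : c = 0 by nra.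
have a1 : a = 1 by lra.
by move: e2; rewrite c0' a1 mul0r mul1r; lra.
Qed.

(** A and B are aligned with the origin and not strictly on the same side of it. Unless A = 0, the
    weights are proportional to - A.B and A.A. *)
Lemma segment_contains_origin A B : det2 A B = 0 -> dot2 A B <= 0 ->
  exists a b, [/\ 0 <= a, 0 <= b & a + b = 1] /\
    a * A.1 + b * B.1 = 0 /\ a * A.2 + b * B.2 = 0.
Proof.
move=> dAB pAB; have [A0|nA0] := eqVneq (dot2 A A) 0.
  by have [-> ->] := dot2_eq0 A A0; exists 1, 0; split; [split; lra|lra].
have AA : 0 < dot2 A A by rewrite lt_neqAle eq_sym nA0 dot2_ge0.
have s0 : 0 < dot2 A A - dot2 A B by lra.
have v1 : - dot2 A B * A.1 + dot2 A A * B.1 = 0.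
  by transitivity (- A.2 * det2 A B); [rewrite /dot2 /det2; ring|rewrite dAB mulr0].
have v2 : - dot2 A B * A.2 + dot2 A A * B.2 = 0.
  by transitivity (A.1 * det2 A B); [rewrite /dot2 /det2; ring|rewrite dAB mulr0].
exists (- dot2 A B / (dot2 A A - dot2 A B)), (dot2 A A / (dot2 A A - dot2 A B)).
split; first split.
- by rewrite divr_ge0 ?oppr_ge0// ltW.
- by rewrite divr_ge0// ltW.
- by rewrite -mulrDl addrC divff// gt_eqF.
- by rewrite ![_ / _ * _]mulrAC -!mulrDl v1 v2 mul0r.
Qed.

(** Cramer: det(B,C) A + det(C,A) B + det(A,B) C = 0, and dividing by the sum of the determinants
    gives nonnegative weights. *)
Lemma same_sign_contains A B C :
  [/\ 0 <= det2 A B, 0 <= det2 B C & 0 <= det2 C A] \/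
  [/\ det2 A B <= 0, det2 B C <= 0 & det2 C A <= 0] ->
  det2 B C + det2 C A + det2 A B != 0 -> triangle_contains_origin A B C.
Proof.
set s3 := det2 A B; set s1 := det2 B C; set s2 := det2 C A.
move=> sgn S0.
exists (s1 / (s1 + s2 + s3)), (s2 / (s1 + s2 + s3)), (s3 / (s1 + s2 + s3)).
have quot (s : R) : [\/ [/\ 0 <= s, 0 <= s1, 0 <= s2 & 0 <= s3] | [/\ s <= 0, s1 <= 0, s2 <= 0 & s3 <= 0]] ->
    0 <= s / (s1 + s2 + s3).
  case=> -[? ? ? ?].
    by rewrite divr_ge0//; lra.
  by rewrite -mulrNN mulr_ge0 ?oppr_ge0// invr_le0; lra.
split; first split.
- by apply: quot; case: sgn => -[? ? ?]; [left|right].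
- by apply: quot; case: sgn => -[? ? ?]; [left|right].
- by apply: quot; case: sgn => -[? ? ?]; [left|right].
- by rewrite -!mulrDl divff.
rewrite ![_ / _ * _]mulrAC -!mulrDl.
have -> : s1 * A.1 + s2 * B.1 + s3 * C.1 = 0 by rewrite /s1 /s2 /s3 /det2; ring.
have -> : s1 * A.2 + s2 * B.2 + s3 * C.2 = 0 by rewrite /s1 /s2 /s3 /det2; ring.
by rewrite mul0r.
Qed.

(** Replaces the existential by polynomial sign conditions, from which measurability can be read
    off. The condition on dot products matters for degenerate triples: three points on one ray have
    zero determinants without surrounding the origin. *)
Lemma triangle_originP A B C : triangle_contains_origin A B C <->
  ([/\ 0 <= det2 A B, 0 <= det2 B C & 0 <= det2 C A] \/
   [/\ det2 A B <= 0, det2 B C <= 0 & det2 C A <= 0]) /\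
  [\/ dot2 A B <= 0, dot2 B C <= 0 | dot2 C A <= 0].
Proof.
set s3 := det2 A B; set s1 := det2 B C; set s2 := det2 C A.
split.
  move=> [a [b [c [[a0 b0 c0 abc] [e1 e2]]]]].
  (* The determinants of a A + b B + c C = 0 with A, B and C in turn. *)
  have E1 : b * s3 = c * s2.
    apply/eqP; rewrite -subr_eq0; apply/eqP.
    transitivity (A.1 * (a * A.2 + b * B.2 + c * C.2) - A.2 * (a * A.1 + b * B.1 + c * C.1)).
      by rewrite /s3 /s2 /det2; ring.
    by rewrite e1 e2 !mulr0 subrr.
  have E2 : c * s1 = a * s3.
    apply/eqP; rewrite -subr_eq0; apply/eqP.
    transitivity (B.1 * (a * A.2 + b * B.2 + c * C.2) - B.2 * (a * A.1 + b * B.1 + c * C.1)).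
      by rewrite /s3 /s1 /det2; ring.
    by rewrite e1 e2 !mulr0 subrr.
  have E3 : a * s2 = b * s1.
    apply/eqP; rewrite -subr_eq0; apply/eqP.
    transitivity (C.1 * (a * A.2 + b * B.2 + c * C.2) - C.2 * (a * A.1 + b * B.1 + c * C.1)).
      by rewrite /s2 /s1 /det2; ring.
    by rewrite e1 e2 !mulr0 subrr.
  have abc' : b + c + a = 1 by lra.
  have abc'' : c + a + b = 1 by lra.
  have n32 := barycentric_sign a b c s1 s2 s3 a0 b0 c0 abc E1 E2.
  have n13 := barycentric_sign b c a s2 s3 s1 b0 c0 a0 abc' E2 E3.
  have n21 := barycentric_sign c a b s3 s1 s2 c0 a0 b0 abc'' E3 E1.
  have [F1 F2 F3] : [/\ b * - s3 = c * - s2, c * - s1 = a * - s3 & a * - s2 = b * - s1].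
    by rewrite !mulrN E1 E2 E3.
  have m32 := barycentric_sign a b c (- s1) (- s2) (- s3) a0 b0 c0 abc F1 F2.
  have m13 := barycentric_sign b c a (- s2) (- s3) (- s1) b0 c0 a0 abc' F2 F3.
  have m21 := barycentric_sign c a b (- s3) (- s1) (- s2) c0 a0 b0 abc'' F3 F1.
  rewrite !oppr_gt0 !oppr_lt0 in m32 m13 m21.
  have pos (x y : R) : (0 < x -> y < 0 -> False) -> 0 < x -> 0 <= y.
    by move=> H x0; rewrite leNgt; apply/negP; exact: H.
  have neg (x y : R) : (x < 0 -> 0 < y -> False) -> x < 0 -> y <= 0.
    by move=> H x0; rewrite leNgt; apply/negP; exact: H.
  have swp (P Q : bool) : (P -> Q -> False) -> Q -> P -> False by move=> H q p; exact: H p q.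
  split.
    case: (ltrgtP s3 0) => s30; rewrite ?lexx.
    - right; split => //; first exact: (neg s3 s1 (swp _ _ n13)).
      exact: (neg s3 s2 m32).
    - left; split => //; first exact: (pos s3 s1 (swp _ _ m13)).
      exact: (pos s3 s2 n32).
    - case: (ltrgtP s1 0) => s10; rewrite ?lexx.
      + by right; split => //; exact: (neg s1 s2 (swp _ _ n21)).
      + by left; split => //; exact: (pos s1 s2 (swp _ _ m21)).
      + by case: (ltrgtP s2 0) => s20; [right|left|left]; split.
  (* If all dot products were positive, expanding the squared norm of this zero combination would
     force a = b = c = 0. *)
  have n0 : dot2 (a * A.1 + b * B.1 + c * C.1, a * A.2 + b * B.2 + c * C.2)
     (a * A.1 + b * B.1 + c * C.1, a * A.2 + b * B.2 + c * C.2) = 0.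
    by rewrite e1 e2 /dot2 /= mulr0 addr0.
  have [|pAB] := leP (dot2 A B) 0; first by constructor 1.
  have [|pBC] := leP (dot2 B C) 0; first by constructor 2.
  have [|pCA] := leP (dot2 C A) 0; first by constructor 3.
  exfalso; move: n0.
  have dpos X Y : 0 < dot2 X Y -> 0 < dot2 X X.
    move=> XY; rewrite lt_neqAle dot2_ge0 andbT eq_sym; apply/eqP => /dot2_eq0[X1 X2].
    by move: XY; rewrite /dot2 X1 X2 !mul0r addr0 ltxx.
  have pA := dpos _ _ pAB; have pB := dpos _ _ pBC; have pC := dpos _ _ pCA.
  have -> : dot2 (a * A.1 + b * B.1 + c * C.1, a * A.2 + b * B.2 + c * C.2)
     (a * A.1 + b * B.1 + c * C.1, a * A.2 + b * B.2 + c * C.2) =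
    a ^+ 2 * dot2 A A + b ^+ 2 * dot2 B B + c ^+ 2 * dot2 C C +
    2 * (a * b * dot2 A B) + 2 * (b * c * dot2 B C) + 2 * (c * a * dot2 C A).
    by rewrite /dot2 /=; ring.
  have t1 : 0 <= a * b * dot2 A B by rewrite !mulr_ge0// ltW.
  have t2 : 0 <= b * c * dot2 B C by rewrite !mulr_ge0// ltW.
  have t3 : 0 <= c * a * dot2 C A by rewrite !mulr_ge0// ltW.
  have u1 : 0 <= a ^+ 2 * dot2 A A by rewrite mulr_ge0 ?sqr_ge0// ltW.
  have u2 : 0 <= b ^+ 2 * dot2 B B by rewrite mulr_ge0 ?sqr_ge0// ltW.
  have u3 : 0 <= c ^+ 2 * dot2 C C by rewrite mulr_ge0 ?sqr_ge0// ltW.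
  have nz (x y : R) : 0 < y -> x ^+ 2 * y = 0 -> x = 0.
    by move=> y0 /eqP; rewrite mulf_eq0 (gt_eqF y0) orbF sqrf_eq0 => /eqP.
  move=> n0.
  have a00 : a = 0 by apply: (nz _ _ pA); lra.
  have b00 : b = 0 by apply: (nz _ _ pB); lra.
  have c00 : c = 0 by apply: (nz _ _ pC); lra.
  by lra.
move=> [sgn dots].
(* Determinants of one sign with zero sum all vanish; the points are then aligned with the origin,
   and the dot product condition puts it on a side. *)
have [S0|S0] := eqVneq (s1 + s2 + s3) 0.
  have [s10 s20 s30] : [/\ s1 = 0, s2 = 0 & s3 = 0] by case: sgn => -[? ? ?]; split; lra.
  case: dots => pt.
  - have [a [b [[a0 b0 ab] [v1 v2]]]] := segment_contains_origin A B s30 pt.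
    by exists a, b, 0; split; [split; lra|rewrite !mul0r !addr0].
  - have [b [c [[b0 c0 bc] [v1 v2]]]] := segment_contains_origin B C s10 pt.
    by exists 0, b, c; split; [split; lra|rewrite !mul0r !add0r].
  - have [c [a [[c0 a0 ca] [v1 v2]]]] := segment_contains_origin C A s20 pt.
    by exists a, 0, c; split; [split; lra|rewrite !mul0r !addr0 ![a * _ + _]addrC].
exact: same_sign_contains.
Qed.

End Triangle.

(** * The probability *)

Section Assembly.
Variable R : realType.
Notation plane := (measurableTypeR R * measurableTypeR R)%type.
Notation mu := (@leb2 R).
Variable r : R -> R.
Hypothesis rP : forall x, r (x + 2 * pi) = r x.
Hypothesis r0 : forall x, 0 < r x.
Hypothesis rC : continuous r.
Notation region := (polar_region r).
Hypothesis area1 : mu region = 1%E.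
Let m_region : measurable (region : set plane) := measurable_region R r rP r0 rC.
Notation half_area := (half_area R r rP r0 rC area1).

Lemma Hhalf_half_area x : Hhalf r x = (half_area x)%:E.
Proof.
rewrite half_areaE (halfplane_area _ r rP r0 rC area1) EFinM /Hhalf; congr (_ * _)%E.
rewrite /Rintegral fineK//.
exact: (integrable_fin_num _ (sqr_integrable R r rC x (x + pi))).
Qed.

(** The tournament to which the results on cyclic triples are applied. *)
Definition ccw : set (plane * plane) :=
  [set p | [/\ region p.1, region p.2 & 0 < det2 R p.1 p.2]].

Lemma measurable_det2 : measurable_fun setT (fun p : plane * plane => det2 R p.1 p.2).
Proof.
have m11 : measurable_fun setT (fun p : plane * plane => p.1.1).
  exact: (measurableT_comp measurable_fst measurable_fst).
have m12 : measurable_fun setT (fun p : plane * plane => p.1.2).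
  exact: (measurableT_comp measurable_snd measurable_fst).
have m21 : measurable_fun setT (fun p : plane * plane => p.2.1).
  exact: (measurableT_comp measurable_fst measurable_snd).
have m22 : measurable_fun setT (fun p : plane * plane => p.2.2).
  exact: (measurableT_comp measurable_snd measurable_snd).
by apply: measurable_funB; apply: measurable_funM.
Qed.

Lemma measurable_dot2 : measurable_fun setT (fun p : plane * plane => dot2 R p.1 p.2).
Proof.
have m11 : measurable_fun setT (fun p : plane * plane => p.1.1).
  exact: (measurableT_comp measurable_fst measurable_fst).
have m12 : measurable_fun setT (fun p : plane * plane => p.1.2).
  exact: (measurableT_comp measurable_snd measurable_fst).
have m21 : measurable_fun setT (fun p : plane * plane => p.2.1).
  exact: (measurableT_comp measurable_fst measurable_snd).
have m22 : measurable_fun setT (fun p : plane * plane => p.2.2).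
  exact: (measurableT_comp measurable_snd measurable_snd).
by apply: measurable_funD; apply: measurable_funM.
Qed.

Lemma measurable_cond (g : plane * plane -> R) (I : interval R) :
  measurable_fun setT g -> measurable [set p | g p \in I].
Proof.
move=> mg; rewrite -[X in measurable X]setTI.
exact: (mg measurableT [set` I]).
Qed.

Lemma measurable_ccw : measurable ccw.
Proof.
have -> : ccw = (region `*` region) `&` [set p | det2 R p.1 p.2 \in `]0, +oo[].
  apply/seteqP; split => p; rewrite /ccw /= in_itv/= andbT.
    by move=> [].
  by move=> [[]].
apply: measurableI; first exact: measurableX.
by apply: measurable_cond; exact: measurable_det2.
Qed.

Lemma det2_polar rho phi b : det2 R (polar R rho phi) b = rho * side R phi b.
Proof. by rewrite /det2 /polar /side /=; ring. Qed.

Lemma ccw_sub : ccw `<=` region `*` region.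
Proof. by move=> p []. Qed.

Lemma ccw_asym a b : ccw (a, b) -> ~ ccw (b, a).
Proof. by move=> [/= _ _ ab] [/= _ _]; rewrite det2C; lra. Qed.

(** For a different from the origin, the uncompared points lie on the null line through a and the
    origin; the origin itself is a null set of values of a. *)
Lemma ccw_total : (mu \x mu)%E ((region `*` region) `\` (ccw `|` [set p | ccw (p.2, p.1)])) = 0%E.
Proof.
set Z := _ `\` _.
have mZ : measurable Z.
  apply: measurableD; first exact: measurableX.
  apply: measurableU; first exact: measurable_ccw.
  by apply: measurable_converse; exact: measurable_ccw.
have sub a : xsection Z a `<=` region `&` [set b | det2 R a b = 0].
  move=> b; rewrite /xsection /= inE => -[[/= ra rb] nD]; split => //=.
  have [ab|ab|//] := ltgtP (det2 R a b) 0; exfalso; apply: nD.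
    by right; split => //=; rewrite det2C; lra.
  by left; split.
have mxZ := measurable_fun_xsection mu mZ.
pose N : set plane := [set (0, 0)].
have mN : measurable N.
  rewrite (_ : N = [set 0] `*` [set 0]); first exact: measurableX.
  by apply/seteqP; split => [p -> //|[x y] [/= -> ->]].
have N0 : mu N = 0%E.
  apply: (subset_measure0 _ _ _ (side_line R 0)) => //; first exact: measurable_line.
  by move=> p ->; rewrite /= /side /= !mulr0 subrr.
rewrite /product_measure1 (@ge0_negligible_integral _ _ _ mu setT N)//.
apply: integral0_eq => a [_ aN].
have [ra|nra] := pselect (region a); last first.
  rewrite /= (_ : xsection Z a = set0) ?measure0//.
  by apply/seteqP; split => // b; rewrite /xsection /= inE => -[[]].
have [rho [phi [/andP[rho0 _] _ aE]]] := region_polar _ r rP a 0 ra.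
have {}rho0 : 0 < rho.
  rewrite lt_neqAle rho0 andbT eq_sym; apply/eqP => rhoz; apply: aN.
  by rewrite aE rhoz /N /polar /= !mul0r.
apply: (subset_measure0 _ _ _ (region_line0 R r rP r0 rC phi)).
- exact: measurable_xsection.
- by apply: measurableI => //; exact: measurable_line.
- move=> b /sub[rb]; rewrite /= aE det2_polar => /eqP.
  by rewrite mulf_eq0 gt_eqF//= => /eqP.
Qed.

Let K (a : plane) : R := fine (mu (xsection ccw a)).

Lemma measurable_left_area : measurable_fun setT K.
Proof.
apply: measurableT_comp => //.
by apply: measurable_fun_xsection; exact: measurable_ccw.
Qed.

Lemma left_area_polar rho phi : 0 < rho -> region (polar R rho phi) ->
  K (polar R rho phi) = half_area phi.
Proof.
move=> rho0 rp; apply: EFin_inj; rewrite half_areaE /K.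
rewrite (_ : xsection ccw (polar R rho phi) = region `&` halfplane R phi).
  exact: (region_measure_fineK _ r rP r0 rC area1 _ (measurable_side_gt0 R phi)).
apply/seteqP; split => b; rewrite /xsection /= ?inE.
  by move=> [/= _ rb]; rewrite det2_polar pmulr_rgt0.
by move=> [rb hb]; split => //=; rewrite det2_polar pmulr_rgt0.
Qed.

Let E : set (plane * plane * plane) :=
  [set t | region t.1.1 /\ region t.1.2 /\ region t.2
             /\ triangle_contains_origin t.1.1 t.1.2 t.2].

Let m1 : measurable_fun setT (fun t : plane * plane * plane => t.1.1).
Proof. exact: (measurableT_comp measurable_fst measurable_fst). Qed.
Let m2 : measurable_fun setT (fun t : plane * plane * plane => t.1.2).
Proof. exact: (measurableT_comp measurable_snd measurable_fst). Qed.
Let m3 : measurable_fun setT (fun t : plane * plane * plane => t.2).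
Proof. exact: measurable_snd. Qed.

(** By [triangle_originP] the event is a finite combination of preimages of closed half-lines under
    determinants and dot products. *)
Lemma measurable_event : measurable E.
Proof.
pose P : set (plane * plane) := [set p | det2 R p.1 p.2 \in `[0, +oo[].
pose M : set (plane * plane) := [set p | det2 R p.1 p.2 \in `]-oo, 0]].
pose Q : set (plane * plane) := [set p | dot2 R p.1 p.2 \in `]-oo, 0]].
have mP : measurable P by apply: measurable_cond; exact: measurable_det2.
have mM : measurable M by apply: measurable_cond; exact: measurable_det2.
have mQ : measurable Q by apply: measurable_cond; exact: measurable_dot2.
pose pull (X : set (plane * plane)) (f g : plane * plane * plane -> plane) := [set t | X (f t, g t)].
pose a (t : plane * plane * plane) := t.1.1.
pose b (t : plane * plane * plane) := t.1.2.
pose c (t : plane * plane * plane) := t.2.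
have mpull X f g : measurable X -> measurable_fun setT f -> measurable_fun setT g -> measurable (pull X f g).
  by move=> *; exact: measurable_pull.
have -> : E = ((region `*` region) `*` region) `&`
   (((pull P a b `&` pull P b c `&` pull P c a) `|` (pull M a b `&` pull M b c `&` pull M c a)) `&`
    (pull Q a b `|` pull Q b c `|` pull Q c a)).
  apply/seteqP; split => -[[x y] z].
    rewrite /E /= => -[rx [ry [rz /triangle_originP[sgn dots]]]]; split => //; split.
      by case: sgn => -[? ? ?]; [left|right]; rewrite /pull /P /M /= !in_itv/= ?andbT.
    by case: dots => ?; [left; left|left; right|right]; rewrite /pull /Q /= !in_itv/=.
  move=> [[[/= rx ry] rz]]; rewrite /pull /P /M /Q /= !in_itv/= ?andbT => -[sgn dots].
  do !split => //; apply/triangle_originP; split.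
    by case: sgn => -[[? ?] ?]; [left|right].
  by case: dots => [[]|] ?; [constructor 1|constructor 2|constructor 3].
apply: measurableI; first by do 2! apply: measurableX => //.
by apply: measurableI; repeat apply: measurableU; repeat apply: measurableI; apply: mpull.
Qed.

(** A cyclic triple has three determinants of one strict sign, so its triangle contains the origin.
    A vertex with both others on its left gives two determinants of strictly opposite signs, which
    excludes the origin. *)
Lemma prob_bounds (h t0 : R) : half_area t0 = h -> (forall x, h <= half_area x) ->
  exists2 V : R, prob_contains_origin r = (4^-1 - 3 * V)%:E &
    2 / 3 * (2^-1 - h) ^+ 3 <= V <= (2^-1 - h) ^+ 2 - 4 / 3 * (2^-1 - h) ^+ 3.
Proof.
move=> kt0 hk.
have [||||||V VE PE] := @measure_cyclic_variance _ _ R mu region ccw m_region area1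
  measurable_ccw ccw_sub ccw_asym ccw_total E measurable_event.
- by move=> t [? [? [? _]]]; split => //; split.
- move=> a b c [/= ra rb ab] [/= _ rc bc] [/= _ _ ca]; do !split => //.
  by apply: same_sign_contains; [left; rewrite !ltW|rewrite gt_eqF//; lra].
- move=> a b c [/= ra rb ba] [/= rc _ cb] [/= _ _ ac]; do !split => //.
  rewrite det2C oppr_gt0 in ba; rewrite det2C oppr_gt0 in cb; rewrite det2C oppr_gt0 in ac.
  by apply: same_sign_contains; [right; rewrite !ltW|rewrite lt_eqF//; lra].
- move=> a b c [_ [_ [_ /triangle_originP[sgn _]]]] [/= _ _ ab] [/= _ _].
  by rewrite det2C oppr_gt0; move: sgn => /= [[]|[]]; lra.
- move=> a b c [_ [_ [_ /triangle_originP[sgn _]]]] [/= _ _ ab] [/= _ _].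
  by rewrite det2C oppr_gt0; move: sgn => /= [[]|[]]; lra.
- move=> a b c [_ [_ [_ /triangle_originP[sgn _]]]] [/= _ _ ab] [/= _ _].
  by rewrite det2C oppr_gt0; move: sgn => /= [[]|[]]; lra.
exists V; first exact: PE.
exact: (variance_bounds _ r rP r0 rC area1 K measurable_left_area left_area_polar h t0 V kt0 hk VE).
Qed.

End Assembly.

Theorem theorem3p3 (R : realType) (r : R -> R) (h : R) :
  (forall x, r (x + 2 * pi) = r x) ->
  (forall x, 0 < r x) ->
  continuous r ->
  piecewise_derivable r ->
  @leb2 R (polar_region r) = 1%E ->
  (exists2 t0, 0 <= t0 <= 2 * pi & Hhalf r t0 = h%:E) ->
  (forall t, 0 <= t <= 2 * pi -> (h%:E <= Hhalf r t)%E) ->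
  ((4^-1 - (1 + 4 * h) * (2^-1 - h) ^+ 2)%:E <= prob_contains_origin r /\
   prob_contains_origin r <= (4^-1 - 2 * (2^-1 - h) ^+ 3)%:E)%E.
Proof.
move=> rP r0 rC _ area1 [t0 _ Ht0] hmin.
have kt0 : half_area R r rP r0 rC area1 t0 = h by apply: EFin_inj; rewrite -Hhalf_half_area.
have hk x : h <= half_area R r rP r0 rC area1 x.
  (* Minimality is assumed on [0, 2 pi] and carried to every angle by periodicity. *)
  have [n nx] := angle_reduction R 0 x.
  rewrite -(periodic_int R _ _ _ (half_areaD2pi R r rP r0 rC area1) n x) -lee_fin -Hhalf_half_area.
  by apply: hmin; move: nx; rewrite add0r => /andP[-> /ltW ->].
(* With d = 1/2 - h, 3 (d^2 - 4/3 d^3) = (3 - 4 d) d^2 = (1 + 4 h) d^2. *)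
have [V -> /andP[V1 V2]] := prob_bounds R r rP r0 rC area1 h t0 kt0 hk.
by rewrite !lee_fin; split; lra.
Qed.
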